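(* Let $\varepsilon>0$ and $\gamma_0\in\mathcal{AC}$. For every $\tau\in(0,1)$ the recursive scheme $$\gamma^\tau_0=\gamma_0,\qquad \gamma^\tau_{n+1}\in\operatorname*{argmin}_{\gamma\in\mathcal{AC}_{\gamma^\tau_n}}\Big\{E(\gamma)+\frac1\tau D(\gamma,\gamma^\tau_n)\Big\}$$ is well posed, i.e. for every $n\in\mathbb N$ the minimization problem attains a minimum. Furthermore, there are constants $c,C>0$ depending only on $\gamma_0$ and $\varepsilon$ (not on $\tau$ or $n$) such that every sequence $(\gamma^\tau_n)_n$ generated by the scheme satisfies, for all $n$, $$c\le|\gamma^\tau_n(1)-\gamma^\tau_n(0)|\le L_{\gamma^\tau_n}\le C,\qquad \int_0^1\kappa_{\gamma^\tau_n}^2\,ds\le C.$$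
   Context: $I=[0,1]$, $s\in I$ is the curve parameter, subscripts $s$ denote (weak) derivatives, $\langle a\mid b\rangle$ is the Euclidean scalar product in $\mathbb R^2$, $\mathcal R$ is the anticlockwise rotation by $\pi/2$, $H^2=H^2(I;\mathbb R^2)$. For a curve $\gamma$ with $\gamma_s\neq0$, $L_\gamma=\int_0^1|\gamma_s|\,ds$ is its length and $\kappa_\gamma=\langle\gamma_{ss}\mid\mathcal R(\gamma_s)\rangle/|\gamma_s|^3$ its curvature. $\mathcal{AC}=\{\gamma\in H^2:|\gamma_s|\equiv\mathrm{const}=L_\gamma,\ \gamma(0)\ne\gamma(1)\}$, and for $\tilde\gamma\in\mathcal{AC}$, $\mathcal{AC}_{\tilde\gamma}=\{\gamma\in\mathcal{AC}:\langle\gamma_s\mid\tilde\gamma_s\rangle\ge0\text{ on }I\}$. For $\gamma,\tilde\gamma\in\mathcal{AC}$, $$E(\gamma)=L_\gamma+\frac\varepsilon2L_\gamma\int_0^1\kappa_\gamma^2\,ds-\log|\gamma(1)-\gamma(0)|,$$ $$D(\gamma,\tilde\gamma)=\frac1{4L_{\tilde\gamma}}\int_0^1\langle\gamma-\tilde\gamma\mid\mathcal R(\tilde\gamma_s)\rangle^2ds+\frac1{4L_\gamma}\int_0^1\langle\gamma-\tilde\gamma\mid\mathcal R(\gamma_s)\rangle^2ds+\frac12|\gamma(0)-\tilde\gamma(0)|^2+\frac12|\gamma(1)-\tilde\gamma(1)|^2.$$ *)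

(* Defs.v *)
From HB Require Import structures.
From mathcomp Require Import all_boot all_order all_algebra.
From mathcomp Require Import all_classical all_reals all_analysis.

Set Implicit Arguments.
Unset Strict Implicit.
Unset Printing Implicit Defensive.

Import Order.TTheory GRing.Theory Num.Theory.
Import numFieldNormedType.Exports.

Local Open Scope classical_set_scope.
Local Open Scope ring_scope.

(* [R * R] carries the sup norm in the library, hence the explicit Euclidean
   structure. *)
Definition dot (R : realType) (a b : R * R) : R := a.1 * b.1 + a.2 * b.2.

Definition enorm (R : realType) (a : R * R) : R := Num.sqrt (dot a a).

Definition rot90 (R : realType) (a : R * R) : R * R := (- a.2, a.1).

Definition unitI (R : realType) : set R := `[0, 1]%classic.
Arguments unitI R : clear implicits.

(* Only the restriction of the integrand to [0, 1] matters. The value is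
   [fine] of the extended real integral; every integrand below is Lebesgue
   integrable as soon as the curves it involves belong to [ACcurve]. *)
Definition intI (R : realType) (f : R -> R) : R :=
  Rintegral (@lebesgue_measure R) (unitI R) f.

Definition L2I (R : realType) (f : R -> R) : Prop :=
  f \_ (unitI R) \in Lfun (@lebesgue_measure R) 2%:E.

(* C^1 functions with compact support in the open interval (0, 1), extended by
   zero to the whole line. *)
Definition test_function (R : realType) (phi : R -> R) : Prop :=
  [/\ forall x, derivable phi x 1,
      continuous (derive1 phi)
    & exists a b : R,
        [/\ 0 < a, b < 1 & forall x, x \notin `[a, b] -> phi x = 0]].

Definition is_wderiv (R : realType) (f g : R -> R) : Prop :=
  L2I g /\ forall phi, test_function phi ->
    intI (fun s => f s * derive1 phi s) = - intI (fun s => g s * phi s).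

Definition H1I (R : realType) (f : R -> R) : Prop :=
  L2I f /\ exists g, is_wderiv f g.

(* A weak derivative is unique up to a null set of [0, 1]; [wderiv] picks a
   representative, and every use of it below is insensitive to the choice. *)
Definition wderiv (R : realType) (f : R -> R) : R -> R :=
  xget (cst 0) [set g | is_wderiv f g].

Definition H2I (R : realType) (f : R -> R) : Prop :=
  H1I f /\ H1I (wderiv f).

Definition curve_deriv (R : realType) (gamma : R -> R * R) : R -> R * R :=
  fun s => (wderiv (fun t => (gamma t).1) s, wderiv (fun t => (gamma t).2) s).

(* An element of H^2(I; R^2) is given by its continuous representative, so
   that the values at 0 and 1 make sense; the values of [gamma] off [0, 1]
   are irrelevant. *)
Definition H2curve (R : realType) (gamma : R -> R * R) : Prop :=
  [/\ {within unitI R, continuous gamma},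
      H2I (fun s => (gamma s).1) & H2I (fun s => (gamma s).2)].

Definition clength (R : realType) (gamma : R -> R * R) : R :=
  intI (fun s => enorm (curve_deriv gamma s)).

Definition curvature (R : realType) (gamma : R -> R * R) (s : R) : R :=
  dot (curve_deriv (curve_deriv gamma) s) (rot90 (curve_deriv gamma s))
    / enorm (curve_deriv gamma s) ^+ 3.

(* [curve_deriv] is only defined up to null sets, so pointwise conditions on it
   are imposed almost everywhere on [0, 1]; they then hold everywhere for the
   continuous representative. *)
Definition ACcurve (R : realType) : set (R -> R * R) :=
  [set gamma | [/\ H2curve gamma,
      {ae (@lebesgue_measure R), forall s, unitI R s ->
         enorm (curve_deriv gamma s) = clength gamma}
    & gamma 0 <> gamma 1]].

Definition ACfrom (R : realType) (gammat : R -> R * R) : set (R -> R * R) :=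
  [set gamma | ACcurve gamma /\
      {ae (@lebesgue_measure R), forall s, unitI R s ->
         0 <= dot (curve_deriv gamma s) (curve_deriv gammat s)}].

Definition energy (R : realType) (eps : R) (gamma : R -> R * R) : R :=
  clength gamma
  + eps / 2 * clength gamma * intI (fun s => curvature gamma s ^+ 2)
  - ln (enorm (gamma 1 - gamma 0)).

Definition dissip (R : realType) (gamma gammat : R -> R * R) : R :=
  (4 * clength gammat)^-1
    * intI (fun s => dot (gamma s - gammat s) (rot90 (curve_deriv gammat s)) ^+ 2)
  + (4 * clength gamma)^-1
    * intI (fun s => dot (gamma s - gammat s) (rot90 (curve_deriv gamma s)) ^+ 2)
  + 2^-1 * enorm (gamma 0 - gammat 0) ^+ 2
  + 2^-1 * enorm (gamma 1 - gammat 1) ^+ 2.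

Definition argmin (R : realType) (T : Type) (A : set T) (F : T -> R) : set T :=
  [set x | A x /\ forall y, A y -> F x <= F y].

Definition step_argmin (R : realType) (eps tau : R) (gammat : R -> R * R) :
    set (R -> R * R) :=
  argmin (ACfrom gammat)
    (fun gamma => energy eps gamma + tau^-1 * dissip gamma gammat).

(* Equality of the initial curve is equality in H^2(I; R^2), i.e. on [0, 1]. *)
Definition scheme_upto (R : realType) (eps tau : R) (gamma0 : R -> R * R)
    (n : nat) (g : nat -> R -> R * R) : Prop :=
  (forall s, unitI R s -> g 0%N s = gamma0 s) /\
  forall k, (k < n)%N -> step_argmin eps tau (g k) (g k.+1).

Definition scheme (R : realType) (eps tau : R) (gamma0 : R -> R * R)
    (g : nat -> R -> R * R) : Prop :=
  (forall s, unitI R s -> g 0%N s = gamma0 s) /\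
  forall k, step_argmin eps tau (g k) (g k.+1).

(* Main.v *)
Require Import Defs.
From HB Require Import structures.
From mathcomp Require Import all_boot all_order all_algebra.
From mathcomp Require Import all_classical all_reals all_analysis.
From mathcomp Require Import measurable_realfun ring lra.
Set Implicit Arguments.
Unset Strict Implicit.
Unset Printing Implicit Defensive.
Import Order.TTheory GRing.Theory Num.Theory.
Import numFieldNormedType.Exports.
Local Open Scope classical_set_scope.
Local Open Scope ring_scope.

(** The direct method. The bound [E >= L - log |gamma(1) - gamma(0)| >= L / 2]
    controls, along a minimizing sequence, the length from above, the chord from
    below and the curvature in L^2; the term [|gamma(0) - gammat(0)|^2] of the
    dissipation controls the position. Constant speed makes [gamma_ss] orthogonal
    to [gamma_s], so that the integral of the squared curvature is
    [L^-4 int |gamma_ss|^2]; hence the [gamma_s] are equi-Hoelder and converge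
    uniformly along an ultrafilter, which passes to the limit in every term but
    the curvature, where lower semicontinuity is enough. The uniform bounds follow
    from [E(gamma_(n+1)) <= E(gamma_n)], obtained by competing with [gamma_n]
    itself, for which the dissipation vanishes. *)

(** * Integration on [0, 1] *)

Section integration_on_unit_interval.
Context {R : realType}.
Notation mu := (@lebesgue_measure R).
Notation I := (unitI R).
Implicit Types (f g h : R -> R).

(** The logarithm is absorbed because the chord is at most the length and [ln x <= x / 2], so half
    of the length survives in the energy. The resulting lower bound on the chord serves three times:
    the limit curve stays open, [ln] is continuous at the limit chord, and [L^-4] stays bounded. The
    obstacle is that the derivatives in the energy are arbitrarily chosen weak derivatives. Each
    admissible curve is therefore first equipped with a continuous tangent, which requires that a
    function with weak derivative [g] be a primitive of [g]; this is obtained by testing with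
    mollified steps at Lebesgue points. Along an ultrafilter every bounded real sequence converges,
    so positions, tangents, lengths and squared norms of second derivatives have limits
    simultaneously, without nested extractions. All that is asked of the second derivatives is a
    weak derivative of the limit tangent whose norm does not exceed the limit of the norms; it
    arises as a strong limit of almost norm-minimal weak derivatives. *)

Definition integrableI f := mu.-integrable I (EFin \o f).

Lemma measurable_unitI : measurable I.
Proof. exact: measurable_itv. Qed.
Hint Resolve measurable_unitI : core.

Lemma mu_unitI : mu I = 1%:E.
Proof. by rewrite lebesgue_measure_itv/= lte_fin ltr01 -EFinD subr0. Qed.

Lemma mem_unitI x : I x <-> 0 <= x <= 1.
Proof. by rewrite /unitI/= in_itv. Qed.

Lemma integrableI_meas f : integrableI f -> measurable_fun I f.
Proof. by move=> /integrableP[/measurable_EFinP]. Qed.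

Lemma integrableID f g : integrableI f -> integrableI g ->
  integrableI (fun x => f x + g x).
Proof.
move=> fi gi; have := @integrableD _ _ _ mu I measurable_unitI _ _ fi gi.
by apply: eq_integrable => // x _ /=; rewrite EFinD.
Qed.

Lemma integrableIZ k f : integrableI f -> integrableI (fun x => k * f x).
Proof.
move=> fi; have := @integrableZl _ _ _ mu I measurable_unitI k _ fi.
by apply: eq_integrable => // x _ /=; rewrite EFinM.
Qed.

Lemma integrableIB f g : integrableI f -> integrableI g ->
  integrableI (fun x => f x - g x).
Proof.
move=> fi gi; have := integrableID fi (integrableIZ (-1) gi).
by apply: eq_integrable => // x _ /=; rewrite mulN1r.
Qed.

Lemma integrableI_le f g : measurable_fun I f -> integrableI g ->
  (forall x, I x -> `|f x| <= `|g x|) -> integrableI f.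
Proof.
move=> mf gi fg; apply: (le_integrable _ _ _ gi) => //.
exact/measurable_EFinP.
Qed.

Lemma intID f g : integrableI f -> integrableI g ->
  intI (fun x => f x + g x) = intI f + intI g.
Proof. by move=> *; exact: RintegralD. Qed.

Lemma intIB f g : integrableI f -> integrableI g ->
  intI (fun x => f x - g x) = intI f - intI g.
Proof. by move=> *; exact: RintegralB. Qed.

Lemma intIZ k f : integrableI f -> intI (fun x => k * f x) = k * intI f.
Proof. by move=> *; exact: RintegralZl. Qed.

Lemma intI_cst (k : R) : intI (fun=> k) = k :> R.
Proof. by rewrite /intI Rintegral_cst// -[X in fine X]/(mu I) mu_unitI mulr1. Qed.

Lemma intI_ge0 f : (forall x, I x -> 0 <= f x) -> 0 <= intI f.
Proof. by move=> f0; exact: (@Rintegral_ge0 _ _ _ mu I). Qed.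

Lemma le_intI f g : integrableI f -> integrableI g ->
  (forall x, I x -> f x <= g x) -> intI f <= intI g.
Proof. by move=> *; exact: le_Rintegral. Qed.

Lemma eq_intI f g : (forall x, I x -> f x = g x) -> intI f = intI g.
Proof. by move=> fg; apply: eq_Rintegral => x; rewrite inE; exact: fg. Qed.

Lemma ae_imply (P Q : R -> Prop) : {ae mu, forall x, I x -> P x} ->
  (forall x, I x -> P x -> Q x) -> {ae mu, forall x, I x -> Q x}.
Proof.
move=> aP PQ; apply: (@filterS _ _ (ae_filter_ringOfSetsType mu) _ _ _ aP).
by move=> x Px Ix; exact: PQ (Px Ix).
Qed.

Lemma ae_and (P Q : R -> Prop) : {ae mu, forall x, I x -> P x} ->
  {ae mu, forall x, I x -> Q x} -> {ae mu, forall x, I x -> P x /\ Q x}.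
Proof.
move=> aP aQ; apply: (@filterS2 _ _ (ae_filter_ringOfSetsType mu) _ _ _ _ aP aQ).
by move=> x Px Qx Ix; split; [exact: Px|exact: Qx].
Qed.

Lemma ae_eq_intI f g : measurable_fun I f -> measurable_fun I g ->
  {ae mu, forall x, I x -> f x = g x} -> intI f = intI g.
Proof.
move=> mf mg fg; congr fine; apply: ae_eq_integral => //.
- exact/measurable_EFinP.
- exact/measurable_EFinP.
- by apply: (ae_imply fg) => x _ /= ->.
Qed.

Lemma L2IP f : L2I f <->
  measurable_fun I f /\ integrableI (fun x => f x ^+ 2).
Proof.
have sqE : (fun x => ((f \_ I) x) ^+ 2) = (fun x => f x ^+ 2) \_ I.
  by apply/funext => x; rewrite !patchE; case: ifP => // _; rewrite expr0n.
have fI : integrableI (fun x => f x ^+ 2) <->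
    mu.-integrable setT (EFin \o (fun x => ((f \_ I) x) ^+ 2)).
  rewrite sqE -restrict_EFin; exact: (@integrable_mkcond _ _ _ mu I _ _).
split.
  move=> f2; split; last exact/fI/Lfun2_integrable_sqr.
  move: f2; rewrite /L2I inE => /andP[+ _]; rewrite inE/= => mf.
  exact: (measurable_restrictT f _).2.
move=> [mf f2]; rewrite /L2I inE; apply/andP; split; rewrite inE/=.
  exact: (measurable_restrictT f _).1.
rewrite /finite_norm unlock /Lnorm poweR_lty//.
move/fI : f2 => /integrableP[_]; apply: le_lt_trans.
rewrite le_eqVlt; apply/orP; left; apply/eqP/eq_integral => x _ /=.
by rewrite normrX powR_mulrn.
Qed.

Lemma L2I_meas f : L2I f -> measurable_fun I f.
Proof. by move=> /L2IP[]. Qed.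

Lemma L2I_sqr f : L2I f -> integrableI (fun x => f x ^+ 2).
Proof. by move=> /L2IP[]. Qed.

Lemma L2I_mul f g : L2I f -> L2I g -> integrableI (fun x => f x * g x).
Proof.
move=> /L2IP[mf f2] /L2IP[mg g2].
apply: (integrableI_le _ (integrableID f2 g2)).
  exact: measurable_funM.
move=> x _; rewrite [leRHS]ger0_norm ?addr_ge0 ?sqr_ge0//.
by rewrite normrM -(real_normK (num_real (f x))) -(real_normK (num_real (g x))); nra.
Qed.

Lemma L2ID f g : L2I f -> L2I g -> L2I (fun x => f x + g x).
Proof.
move=> f2 g2; have [mf fi] := (L2IP _).1 f2; have [mg gi] := (L2IP _).1 g2.
apply/L2IP; split; first exact: measurable_funD.
have := integrableID (integrableID fi gi) (integrableIZ 2 (L2I_mul f2 g2)).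
by apply: eq_integrable => // x _ /=; congr EFin; ring.
Qed.

Lemma L2IZ k f : L2I f -> L2I (fun x => k * f x).
Proof.
move=> /L2IP[mf fi]; apply/L2IP; split; first exact: measurable_funM.
have := integrableIZ (k ^+ 2) fi.
by apply: eq_integrable => // x _ /=; congr EFin; ring.
Qed.

Lemma L2IB f g : L2I f -> L2I g -> L2I (fun x => f x - g x).
Proof.
move=> f2 g2; have := L2ID f2 (L2IZ (-1) g2).
by congr L2I; apply/funext => x; rewrite mulN1r.
Qed.

(** The common class of multipliers: it is stable under algebraic operations, contains continuous
    functions and indicators of half-lines, and maps L^2 to itself by multiplication, so most
    integrability side conditions reduce to it. *)
Definition mbI f := measurable_fun I f /\ exists M : R, forall x, I x -> `|f x| <= M.

Lemma mbI_cst k : mbI (fun=> k).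
Proof. by split; [exact: measurable_cst|exists `|k|]. Qed.

Lemma mbID f g : mbI f -> mbI g -> mbI (fun x => f x + g x).
Proof.
move=> [mf [M fM]] [mg [N gN]]; split; first exact: measurable_funD.
by exists (M + N) => x Ix; rewrite (le_trans (ler_normD _ _))// lerD ?fM ?gN.
Qed.

Lemma mbIM f g : mbI f -> mbI g -> mbI (fun x => f x * g x).
Proof.
move=> [mf [M fM]] [mg [N gN]]; split; first exact: measurable_funM.
by exists (M * N) => x Ix; rewrite normrM ler_pM ?fM ?gN.
Qed.

Lemma mbIB f g : mbI f -> mbI g -> mbI (fun x => f x - g x).
Proof.
move=> fb gb; have := mbID fb (mbIM (mbI_cst (-1)) gb).
by congr mbI; apply/funext => x; rewrite mulN1r.
Qed.

Lemma mbI_sqr f : mbI f -> mbI (fun x => f x ^+ 2).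
Proof. by move=> fb; exact: mbIM. Qed.

Lemma mbI_integrable f : mbI f -> integrableI f.
Proof.
move=> [mf [M fM]]; apply: measurable_bounded_integrable => //.
- by rewrite -[X in (X < _)%E]/(mu I) mu_unitI ltry.
- exists M; split; first exact: num_real.
  by move=> y My x Ix; apply: (le_trans (fM _ Ix)); exact: ltW.
Qed.

Lemma ler_norm_intI f (M : R) : integrableI f -> (forall x, I x -> `|f x| <= M) ->
  `|intI f| <= M.
Proof.
move=> fi fM; apply: (le_trans (@le_normr_Rintegral _ _ _ mu I f _ fi)) => //.
rewrite -[leRHS]intI_cst; apply: le_intI => //; first exact: integrable_norm.
exact/mbI_integrable/mbI_cst.
Qed.

Lemma mbI_L2 f : mbI f -> L2I f.
Proof.
move=> fb; apply/L2IP; split; first by case: fb.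
exact/mbI_integrable/mbI_sqr.
Qed.

Lemma L2I_integrable f : L2I f -> integrableI f.
Proof.
move=> f2; have := L2I_mul f2 (mbI_L2 (mbI_cst 1)).
by apply: eq_integrable => // x _ /=; rewrite mulr1.
Qed.

Lemma L2I_mbM f g : L2I f -> mbI g -> L2I (fun x => f x * g x).
Proof.
move=> /L2IP[mf f2] [mg [M gM]]; apply/L2IP; split; first exact: measurable_funM.
apply: (integrableI_le _ (integrableIZ (M ^+ 2) f2)).
  exact/measurable_funX/measurable_funM.
move=> x Ix; rewrite exprMn mulrC normrM [leRHS]normrM ler_wpM2r// !normrX lerXn2r ?nnegrE//.
by rewrite (le_trans (gM _ Ix)) ?ler_norm.
Qed.

Lemma continuousI_mb f : {within I, continuous f} -> mbI f.
Proof.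
move=> fc; split; first exact: subspace_continuous_measurable_fun.
have := compact_bounded (continuous_compact fc (@segment_compact _ 0 1)).
move=> [M [_ fM]]; exists (M + 1) => x Ix; apply: (fM (M + 1)).
  by rewrite ltrDl.
by exists x.
Qed.

Lemma cauchy_schwarzI f g : L2I f -> L2I g ->
  intI (fun x => f x * g x) ^+ 2 <=
  intI (fun x => f x ^+ 2) * intI (fun x => g x ^+ 2).
Proof.
move=> f2 g2; set a := intI (fun x => f x ^+ 2); set b := intI (fun x => f x * g x).
set c := intI (fun x => g x ^+ 2).
have a0 : 0 <= a by apply: intI_ge0 => x _; rewrite sqr_ge0.
have c0 : 0 <= c by apply: intI_ge0 => x _; rewrite sqr_ge0.
(* Nonnegativity of the quadratic form [(s f + t g)^2] in two parameters; the homogeneous version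
   avoids dividing by [a] or [c], and [(b, - a)], [(- c, b)], [(1, - b)] settle the three cases. *)
have H (s t : R) : 0 <= s ^+ 2 * a + 2 * s * t * b + t ^+ 2 * c.
  rewrite -!intIZ; [|exact: L2I_sqr|exact: L2I_mul|exact: L2I_sqr].
  rewrite -!intID; first by apply: intI_ge0 => x _; have := sqr_ge0 (s * f x + t * g x); nra.
  - by apply: integrableID; apply: integrableIZ; [exact: L2I_sqr|exact: L2I_mul].
  - by apply: integrableIZ; exact: L2I_sqr.
  - by apply: integrableIZ; exact: L2I_sqr.
  - by apply: integrableIZ; exact: L2I_mul.
have [a_gt0|] := ltP 0 a.
  have := H b (- a); rewrite (_ : _ + _ = a * (a * c - b ^+ 2)); last by ring.
  by rewrite pmulr_rge0// subr_ge0.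
move=> a_le0; have a00 : a = 0 by apply/eqP; rewrite eq_le a_le0.
have [c_gt0|c_le0] := ltP 0 c.
  have := H (- c) b; rewrite (_ : _ + _ = c * (a * c - b ^+ 2)); last by ring.
  by rewrite pmulr_rge0// subr_ge0.
have c00 : c = 0 by apply/eqP; rewrite eq_le c_le0.
have := H 1 (- b); rewrite a00 c00 => h; nra.
Qed.

(** A null set contains no nonempty open interval; clamping [x - e] and [x + e] to [[0, 1]] keeps
    the interval nonempty even when [x] is an endpoint. *)
Lemma ae_dense (P : R -> Prop) : {ae mu, forall x, I x -> P x} ->
  forall x e, I x -> 0 < e -> exists y, [/\ I y, `|y - x| < e & P y].
Proof.
move=> [N [mN N0 PN]] x e /mem_unitI/andP[x0 x1] e0; apply/not_existsP => nP.
pose a := Num.max 0 (x - e); pose b := Num.min 1 (x + e).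
have ab : a < b by rewrite /a /b gt_max !lt_min; lra.
have : (0 < mu `]a, b[)%E.
  by rewrite lebesgue_measure_itv/= lte_fin ab -EFinD lte_fin subr_gt0.
rewrite ltNge => /negP; apply; rewrite -N0 le_measure ?inE//.
move=> y /=; rewrite in_itv/= /a /b gt_max lt_min => /andP[/andP[y0 ey] /andP[y1 ye]].
apply: PN => /= Py; have Iy : I y by apply/mem_unitI; lra.
by apply: (nP y); split=> //; [rewrite ltr_norml; lra|exact: Py].
Qed.

End integration_on_unit_interval.
#[global] Hint Extern 0 (measurable (unitI _)) =>
  solve [apply: measurable_unitI] : core.

(** * Mollified step functions *)

Section mollified_step.
Context {R : realType}.
Notation mu := (@lebesgue_measure R).
Notation I := (unitI R).
Implicit Types (f g h : R -> R) (d s t x : R).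

(** The positive part, written with the absolute value so that differentiating its primitive reduces
    to the single function [y * |y|]. *)
Definition ramp (x : R) : R := (`|x| + x) / 2.

(* [max x 0 ^+ 2 / 2] *)
Definition ramp_prim (x : R) : R := (x * `|x| + x ^+ 2) / 4.

Lemma is_derive_sqr_signed (x : R) : is_derive x 1 (fun y => y * `|y|) (2 * `|x|).
Proof.
have sqd (y : R) : is_derive y 1 (fun z : R => z * z) (2 * y).
  by apply: is_derive_eq => /=; rewrite /GRing.scale/=; ring.
have [x0|x0|->] := ltgtP x 0.
- rewrite ltr0_norm//; apply: (@near_eq_is_derive _ _ _ (fun y : R => - (y * y))).
  + near=> y; rewrite ltr0_norm ?mulrN//; near: y; exact: lt_nbhsl.
  + by rewrite mulrN; exact: is_deriveN.
- rewrite gtr0_norm//; apply: (@near_eq_is_derive _ _ _ (fun y : R => y * y)) => //.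
  by near=> y; rewrite gtr0_norm//; near: y; exact: lt_nbhsr.
- rewrite normr0 mulr0.
  (* At the origin the two branches meet; the difference quotient is exactly [|h|]. *)
  have h : (h^-1 *: (((fun y : R => y * `|y|) \o shift 0) (h *: 1) - 0 * `|0 : R|))
      @[h --> (0:R)^'] --> (0:R).
    rewrite mul0r; have : `|h| @[h --> (0:R)^'] --> (0:R).
      have := @norm_continuous _ _ (0 : R); rewrite /continuous_at normr0.
      exact: cvg_within_filter.
    apply: cvg_trans; apply: near_eq_cvg; near=> h.
    have h0 : h != 0 by near: h; exact: nbhs_dnbhs_neq.
    by rewrite /= addr0 subr0 /GRing.scale/= mulr1 mulrA mulVf// mul1r.
  by apply: DeriveDef; [apply/cvg_ex; exists 0|apply/cvg_lim => //; exact: h].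
Unshelve. all: by end_near. Qed.

Lemma is_derive_ramp_prim (a x : R) :
  is_derive x 1 (fun y => ramp_prim (y - a)) (ramp (x - a)).
Proof.
have h : is_derive (x - a) 1 ramp_prim (ramp (x - a)).
  have H := is_derive_sqr_signed (x - a).
  have -> : ramp_prim = (fun y => 4^-1 * (y * `|y| + y ^+ 2)).
    by apply/funext => y; rewrite /ramp_prim mulrC.
  by apply: is_derive_eq; rewrite /ramp /GRing.scale/=; field.
have g : is_derive x 1 (fun y => y - a) (1 - 0) by exact: is_deriveB.
by have := @is_derive1_comp _ _ (fun y => y - a) x _ _ h g; rewrite subr0 mulr1.
Qed.

Lemma ramp_continuous : continuous ramp.
Proof.
move=> x; rewrite /ramp; apply: cvgMl; apply: cvgD; last exact: cvg_id.
exact: norm_continuous.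
Qed.

(* [tent d s] is the hat function of height [d^-1] supported in
   [[s - d, s + d]], and [step d s] its primitive. *)
Definition tent (d s x : R) : R :=
  (ramp (x - (s - d)) - 2 * ramp (x - s) + ramp (x - (s + d))) / d ^+ 2.

Definition step (d s x : R) : R :=
  (ramp_prim (x - (s - d)) - 2 * ramp_prim (x - s) + ramp_prim (x - (s + d)))
  / d ^+ 2.

Lemma is_derive_step d s x : is_derive x 1 (step d s) (tent d s x).
Proof.
have h1 := is_derive_ramp_prim (s - d) x.
have h2 := is_derive_ramp_prim s x.
have h3 := is_derive_ramp_prim (s + d) x.
have -> : step d s = (fun x => (d ^+ 2)^-1 *
    (ramp_prim (x - (s - d)) - 2 * ramp_prim (x - s) + ramp_prim (x - (s + d)))).
  by apply/funext => y; rewrite /step mulrC.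
apply: is_derive_eq; rewrite /tent.
by rewrite /GRing.scale/=; ring.
Qed.

Lemma tent_continuous d s : continuous (tent d s).
Proof.
have rc a : continuous (fun x : R => ramp (x - a)).
  move=> x; apply: (@continuous_comp _ _ _ (fun y => y - a) ramp); last exact: ramp_continuous.
  by apply: cvgB; [exact: cvg_id|exact: cvg_cst].
move=> x; rewrite /tent; apply: cvgMl; apply: cvgD; last exact: rc.
by apply: cvgB; [exact: rc|apply: cvgMr; exact: rc].
Qed.

Lemma rampE (x : R) : ramp x = if 0 <= x then x else 0.
Proof. by rewrite /ramp; case: ifP => x0; [rewrite ger0_norm//; field|rewrite ltr0_norm ?ltNge ?x0//; field]. Qed.

Lemma ramp_primE (x : R) : ramp_prim x = if 0 <= x then x ^+ 2 / 2 else 0.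
Proof. by rewrite /ramp_prim; case: ifP => x0; [rewrite ger0_norm//; field|rewrite ltr0_norm ?ltNge ?x0//; field]. Qed.

Lemma tent_ge0 d s x : 0 < d -> 0 <= tent d s x.
Proof.
move=> d0; rewrite /tent; apply: divr_ge0; last exact: sqr_ge0.
by rewrite !rampE; do 3! case: ifPn; rewrite -?ltNge; lra.
Qed.

Lemma tent_le d s x : 0 < d -> tent d s x <= d^-1.
Proof.
move=> d0; rewrite /tent ler_pdivrMr ?exprn_gt0//.
have -> : d^-1 * d ^+ 2 = d by rewrite expr2 mulrA mulVf ?gt_eqF// mul1r.
by rewrite !rampE; do 3! case: ifPn; rewrite -?ltNge; lra.
Qed.

Lemma tent_out d s x : 0 < d -> d <= `|x - s| -> tent d s x = 0.
Proof.
move=> d0; rewrite ler_normr /tent => /orP xs.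
rewrite [X in X / _](_ : _ = 0) ?mul0r// !rampE.
by case: xs => xs; do 3! case: ifPn; rewrite -?ltNge; lra.
Qed.

Lemma step_left d s x : 0 < d -> x <= s - d -> step d s x = 0.
Proof.
move=> d0 xs; rewrite /step [X in X / _](_ : _ = 0) ?mul0r// !ramp_primE.
do 3! case: ifPn; rewrite -?ltNge => *; try lra.
have -> : x = s - d by lra.
by rewrite subrr expr0n/=; field.
Qed.

Lemma step_right d s x : 0 < d -> s + d <= x -> step d s x = 1.
Proof.
move=> d0 xs; rewrite /step [X in X / _](_ : _ = d ^+ 2) ?divff ?expf_neq0 ?gt_eqF// !ramp_primE.
by do 3! case: ifPn; rewrite -?ltNge => *; try lra; field.
Qed.

Lemma step_ge0 d s x : 0 < d -> 0 <= step d s x.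
Proof.
move=> d0; rewrite /step; apply: divr_ge0; last exact: sqr_ge0.
by rewrite !ramp_primE; do 3! case: ifPn; rewrite -?ltNge => *; nra.
Qed.

Lemma step_le1 d s x : 0 < d -> step d s x <= 1.
Proof.
move=> d0; rewrite /step ler_pdivrMr ?exprn_gt0// mul1r.
by rewrite !ramp_primE; do 3! case: ifPn; rewrite -?ltNge => *; nra.
Qed.

Lemma step_continuous d s : continuous (step d s).
Proof.
move=> x; apply: differentiable_continuous; apply/derivable1_diffP.
by have [] := is_derive_step d s x.
Qed.

Lemma continuous_mbI f : continuous f -> mbI f.
Proof. by move=> fc; apply: continuousI_mb; exact: continuous_subspaceT. Qed.

Lemma intI_tent d s : 0 < d -> d <= s -> s <= 1 - d -> intI (tent d s) = 1.
Proof.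
move=> d0 ds s1.
have H : (\int[mu]_(x in `[0%R, 1%R]) (tent d s x)%:E = (step d s 1)%:E - (step d s 0)%:E)%E.
  apply: continuous_FTC2 => //.
  - exact/continuous_subspaceT/tent_continuous.
  - split.
    + by move=> x _; have [] := is_derive_step d s x.
    + exact/cvg_at_right_filter/step_continuous.
    + exact/cvg_at_left_filter/step_continuous.
  - by move=> x _; rewrite derive1E; have [] := is_derive_step d s x.
rewrite /intI /Rintegral /unitI H -EFinB/=.
have -> : step d s 1 = 1 by apply: step_right; lra.
have -> : step d s 0 = 0 by apply: step_left; lra.
by rewrite subr0.
Qed.

(** A C^1 approximation of the indicator of [[s, t]]: its derivative approximates the difference of
    the Dirac masses at [s] and [t], so the weak formulation tested with it becomes the fundamental
    theorem of calculus as [d] tends to 0. *)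
Lemma test_function_step d s t : 0 < d -> d < s -> s <= t -> t < 1 - d ->
  test_function (fun x => step d s x - step d t x) /\
  derive1 (fun x => step d s x - step d t x) =
    (fun x => tent d s x - tent d t x).
Proof.
move=> d0 ds st t1.
have H x : is_derive x 1 (fun x => step d s x - step d t x) (tent d s x - tent d t x).
  have h1 := is_derive_step d s x; have h2 := is_derive_step d t x.
  exact: is_deriveB.
have E : derive1 (fun x => step d s x - step d t x) =
    (fun x => tent d s x - tent d t x).
  by apply/funext => x; rewrite derive1E; have [] := H x.
split=> //; split.
- by move=> x; have [] := H x.
- by rewrite E => x; apply: cvgB; exact: tent_continuous.
- exists (s - d), (t + d); split; [lra|lra|] => x.
  rewrite in_itv/= negb_and -!ltNge => /orP[] h.
  + by rewrite !step_left ?subrr//; lra.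
  + by rewrite !step_right ?subrr//; lra.
Qed.

End mollified_step.

(** * Weak derivatives and primitives *)

Section fundamental_theorem.
Context {R : realType}.
Notation mu := (@lebesgue_measure R).
Notation I := (unitI R).
Implicit Types (f g h : R -> R) (d s t x : R).

Lemma ler_norm_of_sqr (a e : R) : 0 <= e -> a ^+ 2 <= e ^+ 2 -> `|a| <= e.
Proof.
by move=> e0 ae; rewrite -ler_sqr ?nnegrE// real_normK// num_real.
Qed.

(** The primitive vanishing at 0, written as an integral over all of [[0, 1]] against an indicator
    so that linearity and Cauchy-Schwarz for [intI] apply directly. *)
Definition primI g t : R := intI (fun x => g x * (x <= t)%R%:R).

Lemma mbI_indic_le t : mbI (fun x => (x <= t)%R%:R).
Proof.
split; last by exists 1 => x _; case: (x <= t); rewrite ?normr1 ?normr0.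
rewrite (_ : (fun x => _) = \1_(`]-oo, t]%classic)) //.
by apply/funext => x; rewrite indicE mem_setE in_itv.
Qed.

Lemma primI_itv g : primI g = fun y =>
  \int[mu]_(x in [set` Interval (BLeft 0) (BRight y)]) (g \_ I) x.
Proof.
apply/funext => y; rewrite /primI /intI [LHS]Rintegral_mkcond [RHS]Rintegral_mkcond.
apply: eq_Rintegral => x _; rewrite !patchE !mem_setE /unitI/= !in_itv/=.
by case: (0 <= x) => //=; case: (x <= 1) => //=; case: (x <= y) => //=;
  rewrite ?mulr1 ?mulr0.
Qed.

Lemma primI0 g : primI g 0 = 0.
Proof. by rewrite primI_itv set_itv1 Rintegral_set1. Qed.

Lemma intI_indic (a b : R) : 0 <= a -> a <= b -> b <= 1 ->
  intI (fun x => (x <= b)%R%:R - (x <= a)%R%:R) = b - a.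
Proof.
move=> a0 ab b1.
have H (c : R) : 0 <= c -> c <= 1 -> intI (fun x => (x <= c)%R%:R) = c.
  move=> c0 c1; rewrite /intI.
  transitivity (\int[mu]_(x in I) ((fun=> 1 : R) \_ `]-oo, c]) x).
    apply: eq_Rintegral => x _; rewrite patchE mem_setE in_itv/=.
    by case: (x <= c).
  rewrite -Rintegral_mkcondr.
  have -> : I `&` `]-oo, c] = `[0, c]%classic.
    apply/seteqP; split=> x; rewrite /unitI/= !in_itv/=; lra.
  rewrite Rintegral_cst//= mul1r.
  rewrite -[X in fine X]/(mu `[0, c]%classic) lebesgue_measure_itv/= lte_fin.
  by case: ltP => [_|]; rewrite -?EFinB/= ?subr0//; lra.
rewrite intIB; [|exact/mbI_integrable/mbI_indic_le|exact/mbI_integrable/mbI_indic_le].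
by rewrite !H//; lra.
Qed.

(** Cauchy-Schwarz against the indicator of []s, t]], whose squared norm is [t - s]. The squared
    form avoids square roots throughout. *)
Lemma primI_hoelder g s t : L2I g -> 0 <= s <= 1 -> 0 <= t <= 1 ->
  (primI g t - primI g s) ^+ 2 <= intI (fun x => g x ^+ 2) * `|t - s|.
Proof.
move=> g2; wlog st : s t / s <= t.
  move=> H Is It; have [st|ts] := leP s t; first exact: H.
  by rewrite distrC -sqrrN opprB; apply: H => //; exact: ltW.
move=> Is It.
have ib c := mbI_indic_le c.
have E : primI g t - primI g s = intI (fun x => g x * ((x <= t)%R%:R - (x <= s)%R%:R)).
  rewrite /primI -intIB; last 2 first.
  - exact/L2I_integrable/L2I_mbM.
  - exact/L2I_integrable/L2I_mbM.
  by apply: eq_intI => x _; rewrite mulrBr.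
have hb : mbI (fun x => (x <= t)%R%:R - (x <= s)%R%:R) by exact: mbIB.
rewrite E; apply: (le_trans (cauchy_schwarzI g2 (mbI_L2 hb))).
rewrite ler_wpM2l//; first by apply: intI_ge0 => x _; exact: sqr_ge0.
rewrite ger0_norm ?subr_ge0// -(@intI_indic s t); [|lra|lra|lra].
apply: le_intI.
- exact/mbI_integrable/mbI_sqr.
- exact/mbI_integrable.
- move=> x _; case: (leP x t) => xt; case: (leP x s) => xs;
    rewrite ?subrr ?subr0 ?expr0n ?expr1n//=.
  by rewrite sub0r; lra.
Qed.

Lemma ae_interior : {ae mu, forall x, I x -> 0 < x < 1}.
Proof.
exists ([set 0] `|` [set 1]); split.
- exact: measurableU.
- by rewrite measureU0//; exact: lebesgue_measure_set1.
- move=> x /= /not_implyP[/mem_unitI/andP[x0 x1] /negP]; rewrite negb_and -!leNgt.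
  by move=> /orP[] h; [left|right]; apply/eqP; rewrite eq_le ?x0 ?x1 h.
Qed.

Lemma ae_derive_primI g : L2I g ->
  {ae mu, forall x, I x -> is_derive x 1 (primI g) (g x)}.
Proof.
move=> g2; have gi : mu.-integrable setT (EFin \o (g \_ I)).
  rewrite -restrict_EFin; apply/(@integrable_mkcond _ _ _ mu I) => //.
  exact: L2I_integrable.
have loc : locally_integrable setT (g \_ I).
  by apply: integrable_locally => //; exact: L2I_integrable.
have gy y : mu.-integrable [set` Interval (BLeft 0) (BRight y)] (EFin \o (g \_ I)).
  by apply: integrableS gi.
have := FTC1 gy loc; rewrite /= -primI_itv => H.
apply: (@filterS2 _ _ (ae_filter_ringOfSetsType mu) _ _ _ _ H ae_interior).
move=> x Hx x01 Ix; have /andP[x0 _] := x01 Ix.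
have [dx dE] := Hx x0; apply: DeriveDef => //.
by rewrite -derive1E dE patchE mem_set.
Qed.

Lemma within_eq0 h : {within I, continuous h} ->
  {ae mu, forall x, I x -> h x = 0} -> forall x, I x -> h x = 0.
Proof.
move=> hc h0 x Ix; apply/eqP/negP => /negP hx.
have hx0 : 0 < `|h x| by rewrite normr_gt0.
move/subspace_continuousP : hc => /(_ x Ix)/cvgrPdist_lt/(_ _ hx0).
rewrite near_withinE => /nbhs_ballP[e /= e0 H].
have [y [Iy yx hy]] := ae_dense h0 Ix e0.
have : `|h x - h y| < `|h x| by apply: H => //; rewrite /ball/= distrC.
by rewrite hy subr0 ltxx.
Qed.

Lemma hoelder_continuous h (M : R) : (forall s t, I s -> I t ->
  (h t - h s) ^+ 2 <= M * `|t - s|) -> {within I, continuous h}.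
Proof.
move=> hM; have M0 : 0 <= M.
  have := hM 0 1; rewrite subr0 normr1 mulr1 => h01.
  by apply: (le_trans (sqr_ge0 _)); apply: h01; apply/mem_unitI; lra.
apply/subspace_continuousP => x Ix; apply/cvgrPdist_le => e e0.
rewrite near_withinE; near=> y => Iy.
apply: ler_norm_of_sqr; first exact: ltW.
apply: (le_trans (hM _ _ Iy Ix)).
(* [M + 1] replaces [M] as a divisor because [M] may vanish. *)
have : `|x - y| <= e ^+ 2 / (M + 1).
  near: y; apply: cvgr_dist_le; first exact: cvg_id.
  by rewrite divr_gt0 ?exprn_gt0// ltr_wpDl.
rewrite ler_pdivlMr ?ltr_wpDl// => h1.
by apply: le_trans h1; rewrite mulrC ler_wpM2l// lerDl.
Unshelve. all: by end_near. Qed.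

Lemma primI_continuous g : L2I g -> {within I, continuous (primI g)}.
Proof.
move=> g2; apply: (hoelder_continuous (M := intI (fun x => g x ^+ 2))).
by move=> s t /mem_unitI Is /mem_unitI It; exact: primI_hoelder.
Qed.

(** The tent has mass 1, lives on the ball of radius [d] and is at most [d^-1], twice the density
    [(2 d)^-1] of the uniform average; this is the factor 2. *)
Lemma intI_tent_davg f d s : L2I f -> 0 < d -> d < s -> s < 1 - d ->
  `|f s - intI (fun x => f x * tent d s x)| <= 2 * fine (davg (f \_ I) s d).
Proof.
move=> f2 d0 ds sd.
have tb : mbI (tent d s) by exact/continuous_mbI/tent_continuous.
have Is : I s by apply/mem_unitI; lra.
pose h x : R := `|(f \_ I) x - (f \_ I) s|.
have BI : I `&` ball s d = ball s d.
  apply/setIidr => y; rewrite /ball/= ltr_distlC => /andP[h1 h2].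
  by apply/mem_unitI; lra.
have hi : integrableI h.
  have : integrableI (fun x => f x - f s).
    by apply: integrableIB; [exact: L2I_integrable|exact/mbI_integrable/mbI_cst].
  move=> /integrable_norm; apply: eq_integrable => // x Ix /=.
  by rewrite /h !patchE Ix mem_set.
have hib : mu.-integrable (ball s d) (EFin \o h).
  by apply: (@integrableS _ _ _ mu I) => //; [exact: measurable_ball|rewrite -BI; exact: subIsetl].
have dE : fine (davg (f \_ I) s d) = (d *+ 2)^-1 * \int[mu]_(x in ball s d) h x.
  rewrite /davg /iavg lebesgue_measure_ball ?ltW// inver.
  rewrite gt_eqF ?mulrn_wgt0//.
  rewrite [X in (_ * X)%E](_ : _ = (\int[mu]_(x in ball s d) h x)%:E); last first.
    rewrite /Rintegral fineK; last by apply: integrable_fin_num => //; exact: measurable_ball.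
    by apply: eq_integral.
  by rewrite -EFinM.
have -> : 2 * fine (davg (f \_ I) s d) = d^-1 * \int[mu]_(x in ball s d) h x.
  by rewrite dE mulrA; congr (_ * _); rewrite -(mulr_natl d 2) invfM mulrA divff ?mul1r ?pnatr_eq0.
have -> : f s - intI (fun x => f x * tent d s x) =
    intI (fun x => (f s - f x) * tent d s x).
  have s1 : s <= 1 - d by lra.
  rewrite -[X in X - _]mulr1 -(intI_tent d0 (ltW ds) s1) -intIZ; last exact: mbI_integrable.
  rewrite -intIB.
  - by apply: eq_intI => x _; rewrite mulrBl.
  - exact/integrableIZ/mbI_integrable.
  - exact/L2I_integrable/L2I_mbM.
have fi : integrableI (fun x => (f s - f x) * tent d s x).
  by apply/L2I_integrable/L2I_mbM => //; apply: L2IB => //; exact/mbI_L2/mbI_cst.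
apply: (le_trans (@le_normr_Rintegral _ _ _ mu I _ _ fi)) => //.
have hbi : integrableI (h \_ (ball s d)).
  rewrite /integrableI -restrict_EFin.
  apply/(@integrable_restrict _ _ _ mu (ball s d) _ I) => //; first exact: measurable_ball.
  by rewrite BI.
rewrite -BI Rintegral_mkcondr -RintegralZl//.
apply: le_Rintegral => //; first exact: integrable_norm.
  exact: integrableIZ.
move=> x Ix; rewrite patchE normrM (ger0_norm (tent_ge0 _ _ d0)).
case: ifPn => xb.
  rewrite /h !patchE !mem_set// mulrC distrC ler_wpM2r//.
  exact: tent_le.
rewrite tent_out ?mulr0//.
by move: xb; rewrite notin_setE /ball/= => /negP; rewrite -leNgt distrC.
Qed.

Lemma intI_tent_cvg f s : L2I f -> 0 < s -> s < 1 -> lebesgue_pt (f \_ I) s ->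
  intI (fun x => f x * tent d s x) @[d --> (0:R)^'+] --> f s.
Proof.
move=> f2 s0 s1 /fine_cvgP[_ /cvgrPdist_le L].
apply/cvgrPdist_le => e e0.
have e20 : 0 < e / 2 by rewrite divr_gt0.
have {}L := L _ e20; near=> d.
have d0 : 0 < d by near: d; exact: nbhs_right_gt.
have ds : d < s by near: d; exact: nbhs_right_lt.
have ds1 : d < 1 - s by near: d; apply: nbhs_right_lt; rewrite subr_gt0.
apply: (le_trans (intI_tent_davg f2 d0 ds _)); first by lra.
have : `|0 - fine (davg (f \_ I) s d)| <= e / 2 by near: d.
rewrite sub0r normrN ger0_norm; first by lra.
by apply: fine_ge0; exact: davg_ge0.
Unshelve. all: by end_near. Qed.

Lemma intI_step_cvg g s : L2I g -> 0 < s -> s < 1 ->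
  intI (fun x => g x * step d s x) @[d --> (0:R)^'+] --> intI g - primI g s.
Proof.
move=> g2 s0 s1.
set G := intI (fun x => g x ^+ 2).
have G0 : 0 <= G by apply: intI_ge0 => x _; exact: sqr_ge0.
apply/cvgrPdist_le => e e0; near=> d.
have d0 : 0 < d by near: d; exact: nbhs_right_gt.
have ds : d < s by near: d; exact: nbhs_right_lt.
have ds1 : d < 1 - s by near: d; apply: nbhs_right_lt; rewrite subr_gt0.
(* Chosen so that [2 d G <= e^2]; the [+ 1] covers [G = 0]. *)
have dG : d < e ^+ 2 / (2 * (G + 1)).
  near: d; apply: nbhs_right_lt.
  by rewrite divr_gt0 ?exprn_gt0// mulr_gt0// ltr_wpDl.
(* The gap between the sharp and the mollified step: bounded by 1 and zero outside []s - d, s + d]],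
   hence of squared norm at most [2 d]. *)
pose r x := (1 - (x <= s)%R%:R) - step d s x.
have rb : mbI r.
  apply: mbIB; first by apply: mbIB; [exact: mbI_cst|exact: mbI_indic_le].
  exact/continuous_mbI/step_continuous.
have E : intI g - primI g s - intI (fun x => g x * step d s x) =
    intI (fun x => g x * r x).
  rewrite /primI -!intIB.
  - by apply: eq_intI => x _; rewrite /r; ring.
  - apply: integrableIB; first exact: L2I_integrable.
    apply/L2I_integrable/L2I_mbM => //; exact: mbI_indic_le.
  - apply/L2I_integrable/L2I_mbM => //; exact/continuous_mbI/step_continuous.
  - exact: L2I_integrable.
  - apply/L2I_integrable/L2I_mbM => //; exact: mbI_indic_le.
rewrite E; apply: ler_norm_of_sqr; first exact: ltW.
apply: (le_trans (cauchy_schwarzI g2 (mbI_L2 rb))).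
apply: (@le_trans _ _ (G * (d *+ 2))); last first.
  move: dG; rewrite ltr_pdivlMr ?mulr_gt0 ?ltr_wpDl// => dG.
  by apply: (le_trans _ (ltW dG)); rewrite -mulr_natr; nra.
rewrite ler_wpM2l//.
have -> : d *+ 2 = (s + d) - (s - d) by rewrite mulr2n; ring.
rewrite -(@intI_indic (s - d) (s + d)); [|lra|lra|lra].
apply: le_intI.
- exact/mbI_integrable/mbI_sqr.
- by apply/mbI_integrable/mbIB; exact: mbI_indic_le.
move=> x _; rewrite /r.
have h0 := step_ge0 s x d0; have h1 := step_le1 s x d0.
have [xl|xl] := leP x (s - d).
  rewrite (step_left d0 xl); have -> : x <= s by lra.
  have -> : x <= s + d by lra.
  by rewrite mulr1n !subrr expr0n.
have [xr|xr] := leP x (s + d).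
  case: (x <= s) => /=; nra.
rewrite step_right//; last exact: ltW.
have -> : (x <= s) = false by apply/negbTE; rewrite -ltNge; lra.
by rewrite !subr0 subrr expr0n.
Unshelve. all: by end_near. Qed.

(** Pass to the limit [d -> 0+] in the weak formulation tested with [step d s - step d t]: the tents
    recover the values of [f] because [s] and [t] are Lebesgue points, the steps recover the
    primitive of [g]. *)
Lemma wderiv_diff_lebesgue_pt f g s t : L2I f -> is_wderiv f g ->
  0 < s -> s <= t -> t < 1 ->
  lebesgue_pt (f \_ I) s -> lebesgue_pt (f \_ I) t ->
  f t - f s = primI g t - primI g s.
Proof.
move=> f2 [g2 fg] s0 st t1 ls lt.
have t0 : 0 < t by lra.
have s1 : s < 1 by lra.
have Ls := intI_tent_cvg f2 s0 s1 ls; have Lt := intI_tent_cvg f2 t0 t1 lt.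
have Gs := intI_step_cvg g2 s0 s1; have Gt := intI_step_cvg g2 t0 t1.
have L := cvgB Ls Lt; have G := cvgN (cvgB Gs Gt).
have : f s - f t = - ((intI g - primI g s) - (intI g - primI g t)).
  apply: (cvg_unique _ (L _)) => //=.
  apply: cvg_trans (G _ _); apply: near_eq_cvg; near=> d.
  have d0 : 0 < d by near: d; exact: nbhs_right_gt.
  have ds : d < s by near: d; exact: nbhs_right_lt.
  have dt : d < 1 - t by near: d; apply: nbhs_right_lt; rewrite subr_gt0.
  have t1d : t < 1 - d by lra.
  have [tf dE] := test_function_step d0 ds st t1d.
  have tb c := continuous_mbI (tent_continuous (d := d) (s := c)).
  have sb c := continuous_mbI (step_continuous (d := d) (s := c)).
  have := fg _ tf; rewrite dE => H.
  rewrite /= !fctE -[in RHS]intIB; [|exact/L2I_integrable/L2I_mbM|exact/L2I_integrable/L2I_mbM].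
  rewrite -[in LHS]intIB; [|exact/L2I_integrable/L2I_mbM|exact/L2I_integrable/L2I_mbM].
  transitivity (- intI (fun x => g x * (step d s x - step d t x))).
    by congr (- _); apply: eq_intI => x _; rewrite mulrBr.
  by rewrite -H; apply: eq_intI => x _; rewrite mulrBr.
by move=> ?; lra.
Unshelve. all: by end_near. Qed.

(** Almost every point is an interior Lebesgue point; one of them is fixed as base point and
    determines the constant. *)
Lemma wderiv_primI f g : L2I f -> is_wderiv f g ->
  exists c : R, {ae mu, forall x, I x -> f x = c + primI g x}.
Proof.
move=> f2 fg.
have loc : locally_integrable setT (f \_ I).
  by apply: integrable_locally => //; exact: L2I_integrable.
have L : {ae mu, forall x, I x -> 0 < x < 1 /\ lebesgue_pt (f \_ I) x}.
  apply: ae_and; first exact: ae_interior.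
  have := lebesgue_differentiation loc.
  by apply: (@filterS _ _ (ae_filter_ringOfSetsType mu)) => x.
have I0 : I 0 by apply/mem_unitI; rewrite lexx ler01.
have [s [Is _ [/andP[s0 s1] ls]]] := ae_dense L I0 ltr01.
exists (f s - primI g s); apply: (ae_imply L) => x Ix [/andP[x0 x1] lx].
have [sx|xs] := leP s x.
  by have := wderiv_diff_lebesgue_pt f2 fg s0 sx x1 ls lx; lra.
by have := wderiv_diff_lebesgue_pt f2 fg x0 (ltW xs) s1 lx ls; lra.
Qed.

Lemma wderiv_primI_continuous f g : {within I, continuous f} -> is_wderiv f g ->
  forall x, I x -> f x = f 0 + primI g x.
Proof.
move=> fc fg; have f2 := mbI_L2 (continuousI_mb fc).
have [c fE] := wderiv_primI f2 fg.
have H x : I x -> f x - (c + primI g x) = 0.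
  apply: (@within_eq0 (fun x => f x - (c + primI g x))).
    have pc := primI_continuous fg.1.
    by move=> y; apply: cvgB; [exact: fc|apply: cvgD; [exact: cvg_cst|exact: pc]].
  by apply: (ae_imply fE) => y _ ->; rewrite subrr.
have I0 : I 0 by apply/mem_unitI; rewrite lexx ler01.
move=> x Ix; have := H _ Ix; have := H _ I0; rewrite primI0; lra.
Qed.

Lemma test_function_continuous (phi : R -> R) : test_function phi -> continuous phi.
Proof.
by move=> [phid _ _] x; apply: differentiable_continuous; exact/derivable1_diffP.
Qed.

(** The difference is a weak derivative of 0, so its primitive vanishes on [[0, 1]], and
    differentiating that primitive almost everywhere gives back the difference. *)
Lemma wderiv_ae_unique f g1 g2 : is_wderiv f g1 -> is_wderiv f g2 ->
  {ae mu, forall x, I x -> g1 x = g2 x}.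
Proof.
move=> [g12 fg1] [g22 fg2].
have gi2 : L2I (fun x => g1 x - g2 x) by exact: L2IB.
have W : is_wderiv (fun=> 0) (fun x => g1 x - g2 x).
  split=> // phi tphi.
  have pb := continuous_mbI (test_function_continuous tphi).
  have -> : intI (fun s => 0 * derive1 phi s) = 0.
    by rewrite -[RHS](intI_cst 0); apply: eq_intI => x _; rewrite mul0r.
  have -> : intI (fun s => (g1 s - g2 s) * phi s) =
      intI (fun s => g1 s * phi s) - intI (fun s => g2 s * phi s).
    rewrite -intIB; [|exact/L2I_integrable/L2I_mbM|exact/L2I_integrable/L2I_mbM].
    by apply: eq_intI => x _; rewrite mulrBl.
  by have := fg1 _ tphi; rewrite fg2// => /oppr_inj ->; rewrite subrr oppr0.
have P0 x : I x -> primI (fun x => g1 x - g2 x) x = 0.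
  move=> Ix; have := @wderiv_primI_continuous (fun=> 0) _ _ W _ Ix.
  by rewrite add0r => <- //; apply: continuous_subspaceT => y; exact: cvg_cst.
apply: (ae_imply (ae_and ae_interior (ae_derive_primI gi2))) => x Ix [/andP[x0 x1] D].
apply/eqP; rewrite -subr_eq0; apply/eqP.
have D0 : is_derive x 1 (primI (fun x => g1 x - g2 x)) 0.
  apply: (@near_eq_is_derive _ _ _ (cst (0 : R))).
  near=> y; rewrite P0//; apply/mem_unitI; apply/andP; split; apply: ltW; near: y.
  - exact: lt_nbhsr.
  - exact: lt_nbhsl.
by rewrite -(@derive_val _ _ _ _ _ _ _ D) (@derive_val _ _ _ _ _ _ _ D0).
Unshelve. all: by end_near. Qed.

End fundamental_theorem.

(** * Lower semicontinuity of the Dirichlet energy *)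

Section weak_compactness.
Context {R : realType}.
Notation mu := (@lebesgue_measure R).
Notation I := (unitI R).
Implicit Types (f g h u v w : R -> R) (d s t x e : R).

Definition sqnI f : R := intI (fun x => f x ^+ 2).

Lemma sqnI_ge0 f : 0 <= sqnI f.
Proof. by apply: intI_ge0 => x _; exact: sqr_ge0. Qed.

Lemma le0_geometric (a K : R) : (forall n, a <= K * 2^-1 ^+ n) -> a <= 0.
Proof.
move=> aK; have h : `|2^-1 : R| < 1 by rewrite ger0_norm// invf_lt1// ltr1n.
apply: (@ler_cvg_to _ \oo _ _ (fun=> a) (geometric K 2^-1) _ 0).
- exact: cvg_cst.
- exact: cvg_geometric.
- by apply: nearW => n; exact: aK.
Qed.

(** Integrate Young's inequality [|a| <= a^2 / (2 q) + q / 2]; the weight [q] is optimal when it is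
    the norm itself. *)
Lemma intI_abs_le f (q : R) : 0 < q -> L2I f -> sqnI f <= q ^+ 2 ->
  intI (fun x => `|f x|) <= q.
Proof.
move=> q0 f2 fq.
have fi : integrableI (fun x => `|f x|) by exact/integrable_norm/L2I_integrable.
have H : intI (fun x => `|f x|) <= intI (fun x => (2 * q)^-1 * f x ^+ 2 + q / 2).
  apply: le_intI => //.
    apply: integrableID; [exact/integrableIZ/L2I_sqr|exact/mbI_integrable/mbI_cst].
  move=> x _; rewrite -(real_normK (num_real (f x))); set a := `|f x|.
  have -> : (2 * q)^-1 * a ^+ 2 + q / 2 = a + (2 * q)^-1 * (a - q) ^+ 2.
    by field; rewrite gt_eqF.
  by rewrite lerDl mulr_ge0 ?sqr_ge0// invr_ge0 mulr_ge0// ltW.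
apply: (le_trans H); rewrite intID; [|exact/integrableIZ/L2I_sqr|exact/mbI_integrable/mbI_cst].
rewrite intI_cst intIZ; last exact: L2I_sqr.
apply: (@le_trans _ _ ((2 * q)^-1 * q ^+ 2 + q / 2)).
  by rewrite lerD2r ler_wpM2l// invr_ge0 mulr_ge0// ltW.
by rewrite le_eqVlt; apply/orP; left; apply/eqP; field; rewrite gt_eqF.
Qed.

Lemma summable_cvg (a : nat -> R) :
  (\sum_(n <oo) `|a n.+1 - a n|%:E)%E \is a fin_num -> cvgn a.
Proof.
move=> afin.
have h1 : cvgn (series (fun n => `|a n.+1 - a n|)).
  apply: nondecreasing_is_cvgn; first exact: nondecreasing_series.
  exists (fine (\sum_(n <oo) `|a n.+1 - a n|%:E)%E) => _ [n _ <-].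
  rewrite -lee_fin fineK// /series/= -sumEFin.
  exact: nneseries_lim_ge.
have h2 : cvgn (series (telescope a)) by exact: normed_cvg.
have -> : a = (fun n => a 0%N + series (telescope a) n).
  by apply/funext => n; rewrite -eq_sum_telescope.
by apply: is_cvgD => //; exact: is_cvg_cst.
Qed.

Lemma fatouI (f : nat -> R -> R) h (c : R) : (forall n, integrableI (f n)) ->
  (forall n x, I x -> 0 <= f n x) -> (forall n, intI (f n) <= c) ->
  (forall x, I x -> f n x @[n --> \oo] --> h x) ->
  integrableI h /\ intI h <= c.
Proof.
move=> fi f0 fc fh.
have mh : measurable_fun I h.
  by apply: (@measurable_fun_cvg _ _ _ I f) => // n; exact: integrableI_meas.
have h0 x : I x -> 0 <= h x.
  move=> Ix; apply: (@ler_cvg_to _ \oo _ _ (fun=> 0) (fun n => f n x)).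
  - exact: cvg_cst.
  - exact: fh.
  - by apply: nearW => n; exact: f0.
have H : (\int[mu]_(x in I) (h x)%:E <= c%:E)%E.
  have -> : (\int[mu]_(x in I) (h x)%:E = \int[mu]_(x in I) limn_einf (fun n => (f n x)%:E))%E.
    apply: eq_integral => x; rewrite inE => Ix.
    have /cvg_limn_einf_sup[-> _] // : (f n x)%:E @[n --> \oo] --> (h x)%:E.
    by apply: cvg_EFin; [exact: nearW|exact: fh].
  apply: (le_trans (@fatou _ _ _ mu I _ (fun n x => (f n x)%:E) _ _)) => //.
  - by move=> n; apply/measurable_EFinP; exact: integrableI_meas.
  - rewrite limn_einf_lim; apply: lime_le; first exact: is_cvg_einfs.
    apply: nearW => n; apply: ereal_inf_le.
    exists (\int[mu]_(x in I) (f n x)%:E)%E; first by exists n => /=.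
    have := fc n; rewrite -lee_fin /intI /Rintegral fineK//.
    by apply: integrable_fin_num => //; exact: fi.
have hi : integrableI h.
  apply/integrableP; split; first exact/measurable_EFinP.
  apply: (@le_lt_trans _ _ c%:E); last exact: ltry.
  apply: le_trans H; rewrite le_eqVlt; apply/orP; left; apply/eqP.
  apply: eq_integral => x; rewrite inE => Ix /=.
  by rewrite ger0_norm ?h0.
split=> //; rewrite -lee_fin /intI /Rintegral fineK//.
exact: integrable_fin_num.
Qed.

(** Riesz-Fischer with a prescribed geometric rate: the increments have integrals summing to at most
    2, so the telescoping series converges absolutely almost everywhere, without extracting a
    subsequence. *)
Lemma L2I_complete (v : nat -> R -> R) : (forall n, L2I (v n)) ->
  (forall n m, (n <= m)%N -> sqnI (fun x => v m x - v n x) <= (2^-1 ^+ n) ^+ 2) ->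
  exists w, L2I w /\ forall n, sqnI (fun x => w x - v n x) <= (2^-1 ^+ n) ^+ 2.
Proof.
move=> v2 vC.
pose D x : \bar R := (\sum_(n <oo) `|v n.+1 x - v n x|%:E)%E.
have mv n : measurable_fun I (v n) by exact: L2I_meas.
have mD : measurable_fun I D.
  apply: ge0_emeasurable_sum => // n _.
  apply/measurable_EFinP; apply: measurableT_comp => //.
  exact: measurable_funB.
have Di : mu.-integrable I D.
  apply/integrableP; split=> //.
  under eq_integral => x _ do rewrite gee0_abs ?nneseries_ge0//.
  rewrite integral_nneseries//; last first.
    move=> n; apply/measurable_EFinP; apply: measurableT_comp => //.
    exact: (measurable_funB (mv n.+1) (mv n)).
  apply: (@le_lt_trans _ _ (\sum_(n <oo) (2^-1 ^+ n)%:E)%E).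
    apply: lee_nneseries => [n _ _|n *]; first exact: integral_ge0.
    have q0 : 0 < 2^-1 ^+ n :> R by rewrite exprn_gt0.
    have := intI_abs_le q0 (L2IB (v2 n.+1) (v2 n)) (vC n n.+1 (leqnSn n)).
    rewrite -lee_fin /intI /Rintegral fineK// integrable_fin_num//.
    exact/integrable_norm/L2I_integrable/L2IB.
  have /cvg_lim -> // : (\sum_(0 <= k < n) (2^-1 ^+ k)%:E)%E @[n --> \oo] --> (2 : R)%:E.
    under eq_fun do rewrite sumEFin.
    apply: cvg_EFin; first by apply: nearW.
    have h : `|2^-1 : R| < 1 by rewrite ger0_norm// invf_lt1// ltr1n.
    have := @cvg_geometric_series R 1 _ h.
    have -> : 1 / (1 - 2^-1) = 2 :> R by field.
    apply: cvg_trans; apply: near_eq_cvg; apply: nearW => n /=.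
    by rewrite /series/=; apply: eq_bigr => k _; rewrite mul1r.
  by rewrite ltry.
have [N [mN N0 DN]] := @integrable_ae _ _ _ mu I measurable_unitI _ Di.
(* Setting the sequence to 0 on the exceptional null set makes it converge at every point of
   [[0, 1]], so that the limit is measurable. *)
pose va n x := v n x * \1_(~` N) x.
have m1 : mbI (\1_(~` N) : R -> R).
  split; first by apply: measurable_indic; exact: measurableC.
  by exists 1 => x _; rewrite indicE; case: (_ \in _); rewrite ?normr1 ?normr0.
have va2 n : L2I (va n) by exact: L2I_mbM.
have vaE : {ae mu, forall x, I x -> forall n, va n x = v n x}.
  exists N; split=> // x /= /not_implyP[Ix h]; apply: contrapT => Nx; apply: h => n.
  by rewrite /va indicE mem_set ?mulr1.
have vac x : I x -> cvgn (va^~ x).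
  move=> Ix; have [Nx|Nx] := pselect (N x).
    have -> : va^~ x = (fun=> 0).
      by apply/funext => n; rewrite /va indicE memNset ?mulr0//=; apply.
    exact: is_cvg_cst.
  have -> : va^~ x = v^~ x.
    by apply/funext => n; rewrite /va indicE mem_set ?mulr1.
  apply: summable_cvg; apply: contrapT => Dx; apply: Nx; apply: DN => /= h.
  by apply: Dx; exact: h.
pose w x := limn (va^~ x).
have vaw x : I x -> va n x @[n --> \oo] --> w x by move=> /vac.
have mw : measurable_fun I w.
  by apply: (@measurable_fun_cvg _ _ _ I va) => // n; exact: L2I_meas.
(* Fatou in [m] with [n] fixed: the Cauchy bound does not depend on [m], hence passes to the limit
   with the same rate. *)
have F n : integrableI (fun x => (w x - va n x) ^+ 2) /\
    intI (fun x => (w x - va n x) ^+ 2) <= (2^-1 ^+ n) ^+ 2.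
  apply: (@fatouI (fun m x => (va (m + n)%N x - va n x) ^+ 2)).
  - by move=> m; exact/L2I_sqr/L2IB.
  - by move=> m x _; exact: sqr_ge0.
  - move=> m; apply: le_trans (vC n (m + n)%N (leq_addl _ _)).
    rewrite le_eqVlt; apply/orP; left; apply/eqP; apply: ae_eq_intI.
    + by apply: measurable_funX; apply: measurable_funB; exact: L2I_meas.
    + by apply: measurable_funX; apply: measurable_funB.
    + by apply: (ae_imply vaE) => x _ h; rewrite !h.
  - move=> x Ix; rewrite expr2.
    have h : va (m + n)%N x - va n x @[m --> \oo] --> w x - va n x.
      apply: cvgB; last exact: cvg_cst.
      by rewrite (cvg_shiftn n (va^~ x)); exact: vaw.
    by under eq_fun do rewrite expr2; exact: cvgM.
have w2 : L2I w.
  have -> : w = (fun x => (w x - va 0%N x) + va 0%N x).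
    by apply/funext => x; rewrite subrK.
  apply: L2ID => //; apply/L2IP; split; first exact: measurable_funB mw (L2I_meas (va2 _)).
  exact: (F 0%N).1.
exists w; split=> // n.
have -> : sqnI (fun x => w x - v n x) = sqnI (fun x => w x - va n x).
  apply: ae_eq_intI; [by apply: measurable_funX; apply: measurable_funB| |].
    by apply: measurable_funX; apply: measurable_funB => //; exact: L2I_meas.
  by apply: (ae_imply vaE) => x _ ->.
exact: (F n).2.
Qed.

(** Stated with the midpoint isolated, since the midpoint is the competitor in the minimal-norm
    argument. *)
Lemma sqnI_parallelogram f g : L2I f -> L2I g ->
  sqnI (fun x => f x - g x) =
  2 * sqnI f + 2 * sqnI g - 4 * sqnI (fun x => 2^-1 * (f x + g x)).
Proof.
move=> f2 g2; have fg2 : L2I (fun x => 2^-1 * (f x + g x)) by exact/L2IZ/L2ID.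
rewrite /sqnI -!intIZ; [|exact: L2I_sqr..].
have i1 := integrableIZ 2 (L2I_sqr f2); have i2 := integrableIZ 2 (L2I_sqr g2).
have i3 := integrableIZ 4 (L2I_sqr fg2).
rewrite -intID// -intIB//; last exact: integrableID.
by apply: eq_intI => x _; field.
Qed.

(** Young's inequality on the cross term. When the norm of [r] is at most [q], the last summand is
    at most [q^2 + q], so the perturbation costs only [O(q)]. *)
Lemma sqnI_perturb f r (q : R) : 0 < q -> L2I f -> L2I r ->
  sqnI (fun x => f x + r x) <= (1 + q) * sqnI f + (1 + q^-1) * sqnI r.
Proof.
move=> q0 f2 r2.
rewrite /sqnI -!intIZ; [|exact: L2I_sqr..].
have i1 := integrableIZ (1 + q) (L2I_sqr f2).
have i2 := integrableIZ (1 + q^-1) (L2I_sqr r2).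
rewrite -intID//; apply: le_intI.
- exact/L2I_sqr/L2ID.
- exact: integrableID.
move=> x _; have -> : (1 + q) * f x ^+ 2 + (1 + q^-1) * r x ^+ 2 =
    (f x + r x) ^+ 2 + q^-1 * (q * f x - r x) ^+ 2 by field; rewrite gt_eqF.
by rewrite lerDl mulr_ge0 ?sqr_ge0// invr_ge0 ltW.
Qed.

Lemma wderiv_mean f1 f2 g1 g2 : L2I f1 -> L2I f2 ->
  is_wderiv f1 g1 -> is_wderiv f2 g2 ->
  is_wderiv (fun x => 2^-1 * (f1 x + f2 x)) (fun x => 2^-1 * (g1 x + g2 x)).
Proof.
move=> f12 f22 [g12 fg1] [g22 fg2]; split; first exact/L2IZ/L2ID.
move=> phi tphi; have pb := continuous_mbI (test_function_continuous tphi).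
have db : mbI (derive1 phi) by apply: continuous_mbI; case: tphi.
have E (a b p : R -> R) : L2I a -> L2I b -> mbI p ->
    intI (fun x => 2^-1 * (a x + b x) * p x) =
    2^-1 * (intI (fun x => a x * p x) + intI (fun x => b x * p x)).
  move=> a2 b2 p2; rewrite -intID; [|exact/L2I_integrable/L2I_mbM..].
  rewrite -intIZ; last by apply: integrableID; exact/L2I_integrable/L2I_mbM.
  by apply: eq_intI => x _; ring.
by rewrite !E// fg1// fg2//; ring.
Qed.

(* The elements of minimal norm in the convex sets
   [[set v | exists U, is_wderiv U v /\ |U - u| <= e on I]] form a Cauchy
   sequence as [e] tends to [0], by the parallelogram law: this replaces weak
   compactness of the balls of L^2. *)
Lemma wderiv_lsc u (M : R) : mbI u ->
  (forall e, 0 < e -> exists U v, [/\ L2I U, is_wderiv U v,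
     forall x, I x -> `|U x - u x| <= e & sqnI v <= M + e]) ->
  exists w, is_wderiv u w /\ sqnI w <= M.
Proof.
move=> ub H.
pose S e := [set v | exists U, [/\ L2I U, is_wderiv U v &
  forall x, I x -> `|U x - u x| <= e]].
pose d e := inf (sqnI @` S e).
have lb e : lbound (sqnI @` S e) 0 by move=> _ [v _ <-]; exact: sqnI_ge0.
have ne e : 0 < e -> (sqnI @` S e) !=set0.
  by move=> /H[U [v [U2 Uv Uu _]]]; exists (sqnI v), v => //; exists U.
have hi e : 0 < e -> has_inf (sqnI @` S e).
  by move=> e0; split; [exact: ne|exists 0; exact: lb].
have d_le e v : S e v -> d e <= sqnI v.
  by move=> Sv; apply: ge_inf; [exists 0; exact: lb|exists v].
have d_anti e e' : 0 < e -> e <= e' -> d e' <= d e.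
  move=> e0 ee'; apply: lb_le_inf; first exact: ne.
  move=> _ [v [U [U2 Uv Uu]] <-]; apply: d_le; exists U; split=> // x Ix.
  exact: le_trans (Uu _ Ix) ee'.
have d_M e : 0 < e -> d e <= M.
  move=> e0; apply/ler_addgt0Pr => e' e'0.
  have m0 : 0 < Num.min e e' by rewrite lt_min e0.
  have [U [v [U2 Uv Uu vM]]] := H _ m0.
  apply: (@le_trans _ _ (sqnI v)).
    by apply: d_le; exists U; split=> // x Ix; rewrite (le_trans (Uu _ Ix))// ge_min lexx.
  by apply: (le_trans vM); rewrite lerD2l ge_min lexx orbT.
(* [d] is nonincreasing and bounded by [M], so the supremum [Ds] is its limit at [0+]. *)
pose E := [set d e | e in [set e : R | 0 < e]].
have hE : has_sup E.
  by split; [exists (d 1), 1 => //=|exists M => _ [e e0 <-]; exact: d_M].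
pose Ds := sup E.
have DM : Ds <= M by apply: ge_sup => [|_ [e e0 <-]]; [exact: hE.1|exact: d_M].
have dD e : 0 < e -> d e <= Ds by move=> e0; apply: ub_le_sup; [exact: hE.2|exists e].
pose q n : R := 2^-1 ^+ n.
have q0 n : 0 < q n by rewrite exprn_gt0.
(* The parallelogram law will bound the squared distance by
   [2 eta m + 2 eta n + 4 eta n <= 8 eta n], and this has to equal [q n ^+ 2]. *)
pose eta n : R := q n ^+ 2 / 8.
have eta0 n : 0 < eta n by rewrite divr_gt0// exprn_gt0.
have ex n : exists ev : R * (R -> R), [/\ 0 < ev.1, ev.1 <= q n, S ev.1 ev.2,
    Ds - eta n <= d ev.1 & sqnI ev.2 <= Ds + eta n].
  have [_ [e e0 <-] De] := sup_adherent (eta0 n) hE.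
  have m0 : 0 < Num.min e (q n) by rewrite lt_min e0 q0.
  have [_ [v Sv <-] dv] := inf_adherent (eta0 n) (hi _ m0).
  exists (Num.min e (q n), v); split=> //=.
  - by rewrite ge_min lexx orbT.
  - by apply: (le_trans (ltW De)); apply: d_anti => //; rewrite ge_min lexx.
  - by apply: (le_trans (ltW dv)); rewrite lerD2r; exact: dD.
have [ev evP] := choice ex.
pose v n := (ev n).2; pose e_ n := (ev n).1.
have v2 n : L2I (v n) by have [_ _ [U [_ [] ]]] := evP n.
have vC n m : (n <= m)%N -> sqnI (fun x => v m x - v n x) <= (2^-1 ^+ n) ^+ 2.
  move=> nm; rewrite sqnI_parallelogram//.
  have [en0 _ [Un [Un2 Unv Unu]] dn sn] := evP n.
  have [em0 _ [Um [Um2 Umv Umu]] dm sm] := evP m.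
  have qnm : q m <= q n by rewrite ler_wiXn2l// invf_le1// ler1n.
  have etanm : eta m <= eta n by rewrite /eta; have := q0 n; have := q0 m; nra.
  (* The midpoint is admissible for the larger of the two tolerances, where [d] is already within
     [eta n] of [Ds]. *)
  have : Ds - eta n <= sqnI (fun x => 2^-1 * (v m x + v n x)).
    apply: (@le_trans _ _ (d (Num.max (e_ n) (e_ m)))).
      rewrite maxEle; case: ifP => _ //; apply: le_trans dm.
      by rewrite lerD2l lerN2.
    apply: d_le; exists (fun x => 2^-1 * (Um x + Un x)); split.
    - exact/L2IZ/L2ID.
    - exact: wderiv_mean.
    - move=> x Ix; have h1 := Unu _ Ix; have h2 := Umu _ Ix.
      have h3 : e_ n <= Num.max (e_ n) (e_ m) by rewrite le_max lexx.
      have h4 : e_ m <= Num.max (e_ n) (e_ m) by rewrite le_max lexx orbT.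
      have -> : 2^-1 * (Um x + Un x) - u x = 2^-1 * ((Um x - u x) + (Un x - u x)) by field.
      rewrite normrM ger0_norm ?invr_ge0// ler_pdivrMl//.
      apply: (le_trans (ler_normD _ _)).
      by move: h1 h2 h3 h4; rewrite -/(e_ n) -/(e_ m); lra.
  have e8 : 8 * eta n = q n ^+ 2 by rewrite /eta; field.
  rewrite -/(q n) -e8; rewrite -/(v m) in sm; rewrite -/(v n) in sn.
  by move=> ?; lra.
have [w [w2 wv]] := L2I_complete v2 vC.
have M0 : 0 <= M by apply: le_trans (d_M 1 ltr01); apply: lb_le_inf; [exact: ne|exact: lb].
exists w; split; last first.
  (* With [Q = q n <= 1], the bound [(1 + Q) (M + Q^2 / 8) + Q^2 + Q] exceeds [M] by at most
     [(M + 3) Q]. *)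
  rewrite -subr_le0; apply: (@le0_geometric _ (M + 3)) => n.
  rewrite -/(q n).
  have -> : w = (fun x => v n x + (w x - v n x)) by apply/funext => x; rewrite addrC subrK.
  have r2 : L2I (fun x => w x - v n x) by exact: L2IB.
  have := sqnI_perturb (q0 n) (v2 n) r2.
  have [_ _ _ _ sn] := evP n; rewrite -/(v n) in sn.
  have := wv n; rewrite -/(q n) => rq.
  have q1 : q n <= 1 by rewrite exprn_ile1// invf_le1// ler1n.
  have h1 : (1 + (q n)^-1) * sqnI (fun x => w x - v n x) <= q n ^+ 2 + q n.
    apply: (@le_trans _ _ ((1 + (q n)^-1) * q n ^+ 2)).
      by rewrite ler_wpM2l// addr_ge0// invr_ge0 ltW.
    by rewrite mulrDl mul1r lerD2l expr2 mulrA mulVf ?gt_eqF ?mul1r.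
  have h2 : (1 + q n) * sqnI (v n) <= (1 + q n) * (M + q n ^+ 2 / 8).
    have q1_ge0 : 0 <= 1 + q n by rewrite addr_ge0// ltW.
    by rewrite ler_wpM2l// (le_trans sn)// lerD2r.
  have := q0 n; move: h1 h2 q1; set a := sqnI _; set b := sqnI _; set c := sqnI _.
  by rewrite expr2; set Q := q n => *; nra.
split=> // phi tphi.
have pb := continuous_mbI (test_function_continuous tphi).
have db : mbI (derive1 phi) by apply: continuous_mbI; case: tphi.
have [_ [K dK]] := db.
have K0 : 0 <= K by apply: le_trans (dK 0 _); rewrite ?normr_ge0//; apply/mem_unitI; lra.
pose P := sqnI phi; have P0 : 0 <= P by exact: sqnI_ge0.
apply/eqP; rewrite -subr_eq0 opprK -normr_le0.
apply: (@le0_geometric _ (K + P + 1)) => n; rewrite -/(q n).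
have [e0 eq_ [U [U2 [_ Uv] Uu]] _ _] := evP n.
(* The identity holds exactly for the pair [U], [v n], so the defect of [u], [w] only contains the
   uniform error [U - u] and the L^2 error [w - v n], both of order [q n]. *)
have -> : intI (fun s => u s * phi^`()%classic s) + intI (fun s => w s * phi s) =
   - intI (fun s => (U s - u s) * phi^`()%classic s) + intI (fun s => (w s - v n s) * phi s).
  have -> : intI (fun s => (U s - u s) * phi^`()%classic s) =
      intI (fun s => U s * phi^`()%classic s) - intI (fun s => u s * phi^`()%classic s).
    rewrite -intIB; first by apply: eq_intI => x _; rewrite mulrBl.
    - exact/L2I_integrable/L2I_mbM.
    - exact/mbI_integrable/mbIM.
  have -> : intI (fun s => (w s - v n s) * phi s) =
      intI (fun s => w s * phi s) - intI (fun s => v n s * phi s).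
    rewrite -intIB; first by apply: eq_intI => x _; rewrite mulrBl.
    - exact/L2I_integrable/L2I_mbM.
    - exact/L2I_integrable/L2I_mbM.
  by rewrite Uv//; ring.
apply: (le_trans (ler_normD _ _)); rewrite normrN.
have h1 : `|intI (fun s => (U s - u s) * phi^`()%classic s)| <= q n * K.
  apply: ler_norm_intI.
    by apply/L2I_integrable/L2I_mbM => //; apply: L2IB => //; exact: mbI_L2.
  move=> x Ix; rewrite normrM ler_pM// ?dK// (le_trans (Uu _ Ix))//.
(* [P + 1] bounds the norm of [phi] without a square root, since [P <= (P + 1)^2]. *)
have h2 : `|intI (fun s => (w s - v n s) * phi s)| <= q n * (P + 1).
  apply: ler_norm_of_sqr; first by rewrite mulr_ge0// ?addr_ge0// ltW.
  have r2 : L2I (fun x => w x - v n x) by exact: L2IB.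
  apply: (le_trans (cauchy_schwarzI r2 (mbI_L2 pb))).
  rewrite -/(sqnI _) -/(sqnI _) -/P exprMn.
  apply: ler_pM; [exact: sqnI_ge0|exact: P0|exact: wv|by rewrite expr2; nra].
by rewrite mulrC; nra.
Qed.

End weak_compactness.

(** * Curves of constant speed *)

Section curves.
Context {R : realType}.
Notation mu := (@lebesgue_measure R).
Notation I := (unitI R).
Implicit Types (f g : R -> R) (gam u w : R -> R * R) (s t x L : R).

Definition cx (gam : R -> R * R) : R -> R := fun x => (gam x).1.
Definition cy (gam : R -> R * R) : R -> R := fun x => (gam x).2.

Lemma wderivP f g : is_wderiv f g -> is_wderiv f (wderiv f).
Proof. by move=> fg; rewrite /wderiv; case: xgetP => [h ->//|/(_ g)]. Qed.

Lemma eq_is_wderiv f1 f2 g : (forall x, I x -> f1 x = f2 x) ->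
  is_wderiv f1 g -> is_wderiv f2 g.
Proof.
move=> f12 [g2 fg]; split=> // phi tphi; rewrite -fg//.
by apply: eq_intI => x Ix; rewrite f12.
Qed.

(** Equality holds everywhere and not just almost everywhere, because both sides choose from the
    same set. Functions of the curve derivative thus depend only on the curve on [[0, 1]]. *)
Lemma eq_wderiv f1 f2 : (forall x, I x -> f1 x = f2 x) -> wderiv f1 = wderiv f2.
Proof.
move=> f12; rewrite /wderiv; congr (xget _ _); apply/seteqP; split=> g /=.
  exact: eq_is_wderiv.
by apply: eq_is_wderiv => x Ix; rewrite f12.
Qed.

Lemma ae_is_wderiv f1 f2 g1 g2 : is_wderiv f1 g1 -> L2I f1 -> L2I f2 -> L2I g2 ->
  {ae mu, forall x, I x -> f1 x = f2 x} -> {ae mu, forall x, I x -> g1 x = g2 x} ->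
  is_wderiv f2 g2.
Proof.
move=> [g12 fg] f12 f22 g22 f12E g12E; split=> // phi tphi.
have [mp _] := continuous_mbI (test_function_continuous tphi).
have [md _] : mbI (derive1 phi) by apply: continuous_mbI; case: tphi.
have m := L2I_meas.
transitivity (intI (fun x => f1 x * derive1 phi x)).
  apply: ae_eq_intI; [by apply: measurable_funM => //; exact: m|by apply: measurable_funM => //; exact: m|].
  by apply: (ae_imply f12E) => x _ ->.
rewrite fg//; congr (- _).
apply: ae_eq_intI; [by apply: measurable_funM => //; exact: m|by apply: measurable_funM => //; exact: m|].
by apply: (ae_imply g12E) => x _ ->.
Qed.

(* [u] is the continuous representative of gamma_s, [w] represents gamma_ss. *)
Record h2rep gam u w L : Prop := H2Rep {
  rep_cx : {within I, continuous (cx gam)} ;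
  rep_cy : {within I, continuous (cy gam)} ;
  rep_ux : {within I, continuous (cx u)} ;
  rep_uy : {within I, continuous (cy u)} ;
  rep_dx : is_wderiv (cx gam) (cx u) ;
  rep_dy : is_wderiv (cy gam) (cy u) ;
  rep_ddx : is_wderiv (cx u) (cx w) ;
  rep_ddy : is_wderiv (cy u) (cy w) ;
  rep_ge0 : 0 <= L ;
  rep_speed : forall x, I x -> dot (u x) (u x) = L ^+ 2 }.

(** The inner choice in [wderiv (wderiv f)] affects what the outer one differentiates; almost
    everywhere uniqueness at both levels makes the choices harmless. *)
Lemma wderiv_rep f g h : {within I, continuous f} -> {within I, continuous g} ->
  is_wderiv f g -> is_wderiv g h ->
  [/\ H2I f, {ae mu, forall x, I x -> wderiv f x = g x} &
      {ae mu, forall x, I x -> wderiv (wderiv f) x = h x}].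
Proof.
move=> fc gc fg gh.
have f2 := mbI_L2 (continuousI_mb fc); have g2 := mbI_L2 (continuousI_mb gc).
have W1 := wderivP fg.
have E1 := wderiv_ae_unique W1 fg.
have W2 : is_wderiv (wderiv f) h.
  apply: (ae_is_wderiv gh g2 W1.1 gh.1); last exact: aeW.
  by apply: (ae_imply E1) => x _ ->.
split=> //; last exact: wderiv_ae_unique (wderivP W2) W2.
by split; split=> //; [exists g|exact: W1.1|exists h].
Qed.

Lemma rep_ae gam u w L : h2rep gam u w L ->
  {ae mu, forall x, I x -> curve_deriv gam x = u x /\
    curve_deriv (curve_deriv gam) x = w x}.
Proof.
move=> [cx_ cy_ ux uy dx dy ddx ddy _ _].
have [_ ex1 ex2] := wderiv_rep cx_ ux dx ddx.
have [_ ey1 ey2] := wderiv_rep cy_ uy dy ddy.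
apply: (ae_imply (ae_and (ae_and ex1 ex2) (ae_and ey1 ey2))).
move=> x _ [[h1 h2] [h3 h4]]; rewrite /curve_deriv; split.
  by rewrite [LHS](_ : _ = (wderiv (cx gam) x, wderiv (cy gam) x))// h1 h3 /cx /cy -surjective_pairing.
by rewrite [LHS](_ : _ = (wderiv (wderiv (cx gam)) x, wderiv (wderiv (cy gam)) x))// h2 h4 /cx /cy -surjective_pairing.
Qed.

Lemma measurable_sqrt_comp f : measurable_fun I f ->
  measurable_fun I (fun x => Num.sqrt (f x)).
Proof.
move=> mf; apply: (@measurableT_comp _ _ _ _ _ _ (@Num.sqrt R)) => //.
apply: continuous_measurable_fun; exact: sqrt_continuous.
Qed.

(** Inversion is discontinuous at 0; the detour goes through the real power with exponent [-1],
    which is measurable and agrees with inversion on nonnegative numbers, 0 included. *)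
Lemma measurable_inv_comp f : measurable_fun I f -> (forall x, 0 <= f x) ->
  measurable_fun I (fun x => (f x)^-1).
Proof.
move=> mf f0; have -> : (fun x => (f x)^-1) = (fun x => f x `^ (-1)).
  by apply/funext => x; rewrite powR_inv1.
exact: (@measurableT_comp _ _ _ _ _ _ (@powR R ^~ (-1))).
Qed.

Definition measI2 gam := measurable_fun I (cx gam) /\ measurable_fun I (cy gam).

Lemma measurable_dot (a b : R -> R * R) : measI2 a -> measI2 b ->
  measurable_fun I (fun x => dot (a x) (b x)).
Proof.
move=> [ax ay] [bx by_]; rewrite /dot.
by apply: measurable_funD; apply: measurable_funM.
Qed.

Lemma measI2_rot (a : R -> R * R) : measI2 a -> measI2 (fun x => rot90 (a x)).
Proof. by move=> [ax ay]; split => //; apply: measurable_funN. Qed.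

Lemma measI2B (a b : R -> R * R) : measI2 a -> measI2 b -> measI2 (fun x => a x - b x).
Proof.
move=> [ax ay] [bx by_]; split.
- exact: (measurable_funB ax bx).
- exact: (measurable_funB ay by_).
Qed.

Lemma measurable_enorm (a : R -> R * R) : measI2 a ->
  measurable_fun I (fun x => enorm (a x)).
Proof. by move=> ma; apply: measurable_sqrt_comp; exact: measurable_dot. Qed.

Lemma rep_meas gam u w L : h2rep gam u w L ->
  [/\ measI2 gam, measI2 u, measI2 w, measI2 (curve_deriv gam) &
      measI2 (curve_deriv (curve_deriv gam))].
Proof.
move=> [cx_ cy_ ux uy dx dy ddx ddy _ _].
have [[_ hx] _ _] := wderiv_rep cx_ ux dx ddx.
have [[_ hy] _ _] := wderiv_rep cy_ uy dy ddy.
have Wx := wderivP dx; have Wy := wderivP dy.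
case: hx => _ [g1 /wderivP WWx]; case: hy => _ [g2 /wderivP WWy].
split; split.
- by case: (continuousI_mb cx_).
- by case: (continuousI_mb cy_).
- by case: (continuousI_mb ux).
- by case: (continuousI_mb uy).
- exact: L2I_meas ddx.1.
- exact: L2I_meas ddy.1.
- exact: L2I_meas Wx.1.
- exact: L2I_meas Wy.1.
- exact: L2I_meas WWx.1.
- exact: L2I_meas WWy.1.
Qed.

Lemma dot_ge0 (a : R * R) : 0 <= dot a a.
Proof. by rewrite /dot -!expr2 addr_ge0 ?sqr_ge0. Qed.

Lemma enorm_ge0 (a : R * R) : 0 <= enorm a.
Proof. exact: sqrtr_ge0. Qed.

Lemma sqr_enorm (a : R * R) : enorm a ^+ 2 = dot a a.
Proof. by rewrite sqr_sqrtr// dot_ge0. Qed.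

Lemma enorm_eq (a : R * R) L : 0 <= L -> dot a a = L ^+ 2 -> enorm a = L.
Proof. by move=> L0 aL; rewrite /enorm aL sqrtr_sqr ger0_norm. Qed.

Lemma rep_clength gam u w L : h2rep gam u w L -> clength gam = L.
Proof.
move=> r; have [_ _ _ md _] := rep_meas r.
rewrite /clength -[RHS](intI_cst L); apply: ae_eq_intI.
- exact: measurable_enorm.
- exact: measurable_cst.
- apply: (ae_imply (rep_ae r)) => x Ix [-> _].
  exact: enorm_eq (rep_ge0 r) (rep_speed r Ix).
Qed.

Lemma rep_AC gam u w L : h2rep gam u w L -> gam 0 <> gam 1 -> ACcurve gam.
Proof.
move=> r g01; have lE := rep_clength r; have A := rep_ae r.
have speed := rep_speed r; have L0 := rep_ge0 r.
case: r => cx_ cy_ ux uy dx dy ddx ddy _ _.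
have [hx _ _] := wderiv_rep cx_ ux dx ddx.
have [hy _ _] := wderiv_rep cy_ uy dy ddy.
split; last exact: g01.
  split; [|exact: hx|exact: hy]; have -> : gam = (fun x => (cx gam x, cy gam x)).
    by apply/funext => x; rewrite /cx /cy -surjective_pairing.
  by move=> x; exact: (cvg_pair (cx_ x) (cy_ x)).
by rewrite lE; apply: (ae_imply A) => x Ix [-> _]; exact: enorm_eq L0 (speed _ Ix).
Qed.

(** The weak derivative is itself in H^1, hence almost everywhere equal to a constant plus the
    primitive of its own weak derivative, which is continuous. *)
Lemma wderiv_crep f : H2I f -> {within I, continuous f} -> exists g h : R -> R,
  [/\ {within I, continuous g}, is_wderiv f g, is_wderiv g h &
     {ae mu, forall x, I x -> wderiv f x = g x}].
Proof.
move=> [[f2 [g0 fg0]] [wf2 [h0 gh0]]] fc.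
have fg := wderivP fg0; have gh := wderivP gh0.
have [c cE] := wderiv_primI wf2 gh.
have gc : {within I, continuous (fun x => c + primI (wderiv (wderiv f)) x)}.
  have pc := primI_continuous gh.1.
  by move=> y; apply: cvgD; [exact: cvg_cst|exact: pc].
have g2 := mbI_L2 (continuousI_mb gc).
exists (fun x => c + primI (wderiv (wderiv f)) x), (wderiv (wderiv f)).
split; [exact: gc| | |exact: cE].
- by apply: (ae_is_wderiv fg f2 f2 g2); [exact: aeW|exact: cE].
- by apply: (ae_is_wderiv gh wf2 g2 gh.1); [exact: cE|exact: aeW].
Qed.

(** For the continuous tangent, the almost everywhere constancy of the speed becomes an identity at
    every point, by density. *)
Lemma AC_rep gam : ACcurve gam -> exists u w, h2rep gam u w (clength gam).
Proof.
move=> [[gc hx hy] sp _].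
have cx_ : {within I, continuous (cx gam)}.
  by move=> x; apply: (@continuous_comp (subspace I) _ _ gam fst); [exact: gc|exact: cvg_fst].
have cy_ : {within I, continuous (cy gam)}.
  by move=> x; apply: (@continuous_comp (subspace I) _ _ gam snd); [exact: gc|exact: cvg_snd].
have [ux [wx [uxc dx ddx ex]]] := wderiv_crep hx cx_.
have [uy [wy [uyc dy ddy ey]]] := wderiv_crep hy cy_.
exists (fun x => (ux x, uy x)), (fun x => (wx x, wy x)).
split; [exact: cx_|exact: cy_|exact: uxc|exact: uyc|exact: dx|exact: dy
  |exact: ddx|exact: ddy| |].
  by apply: intI_ge0 => x _; exact: enorm_ge0.
have H x : I x -> (ux x * ux x + uy x * uy x) - clength gam ^+ 2 = 0.
  apply: (@within_eq0 _ (fun x => (ux x * ux x + uy x * uy x) - clength gam ^+ 2)).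
    move=> y; apply: cvgB; last exact: cvg_cst.
    by apply: cvgD; apply: cvgM; [exact: uxc|exact: uxc|exact: uyc|exact: uyc].
  apply: (ae_imply (ae_and sp (ae_and ex ey))) => y _ [<- [h1 h2]].
  by rewrite sqr_enorm /dot /curve_deriv/= -/(cx gam) -/(cy gam) h1 h2 subrr.
by move=> x Ix; apply/eqP; rewrite -subr_eq0; apply/eqP; exact: H.
Qed.

Lemma rep_bound gam u w L : h2rep gam u w L -> forall x, I x ->
  `|cx u x| <= L /\ `|cy u x| <= L.
Proof.
move=> r x Ix; have := rep_speed r Ix; rewrite /dot -/(cx u x) -/(cy u x) => h.
have L0 := rep_ge0 r.
by split; apply: ler_norm_of_sqr => //; rewrite -h -!expr2 ?lerDl ?lerDr sqr_ge0.
Qed.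

Lemma rep_ortho gam u w L : h2rep gam u w L ->
  {ae mu, forall x, I x -> dot (w x) (u x) = 0}.
Proof.
move=> r; have speed := rep_speed r; case: r => cx_ cy_ ux uy dx dy ddx ddy _ _.
have ex := wderiv_primI_continuous ux ddx.
have ey := wderiv_primI_continuous uy ddy.
have D := ae_and (ae_derive_primI ddx.1) (ae_derive_primI ddy.1).
apply: (ae_imply (ae_and ae_interior D)) => x Ix [/andP[x0 x1] [Dx Dy]].
(* [N] is the squared speed written with primitives, whose derivatives are known at almost every
   point; it agrees with the constant [L ^+ 2] on [[0, 1]], enough at an interior point. *)
pose N y := (cx u 0 + primI (cx w) y) ^+ 2 + (cy u 0 + primI (cy w) y) ^+ 2.
have DN : is_derive x 1 N (2 * dot (w x) (u x)).
  rewrite /N; apply: is_derive_eq.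
  rewrite /dot -/(cx w x) -/(cx u x) -/(cy w x) -/(cy u x) (ex x Ix) (ey x Ix).
  by rewrite /GRing.scale/=; ring.
have DL : is_derive x 1 N 0.
  apply: (@near_eq_is_derive _ _ _ (cst (L ^+ 2))).
  near=> y; have Iy : I y.
    apply/mem_unitI; apply/andP; split; apply: ltW; near: y; [exact: lt_nbhsr|exact: lt_nbhsl].
  by rewrite /N -(ex y Iy) -(ey y Iy) -(speed y Iy) /dot -!expr2.
have : 2 * dot (w x) (u x) = 0.
  by rewrite -(@derive_val _ _ _ _ _ _ _ DN) (@derive_val _ _ _ _ _ _ _ DL).
by move/eqP; rewrite mulf_eq0 pnatr_eq0/= => /eqP.
Unshelve. all: by end_near. Qed.

Lemma rep_curvature gam u w L : h2rep gam u w L -> 0 < L ->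
  intI (fun x => curvature gam x ^+ 2) = (sqnI (cx w) + sqnI (cy w)) / L ^+ 4.
Proof.
move=> r L0; have [_ mu_ mw md mdd] := rep_meas r.
have wx2 := L2I_sqr (rep_ddx r).1; have wy2 := L2I_sqr (rep_ddy r).1.
rewrite /sqnI -intID// mulrC -intIZ; last exact: integrableID.
apply: ae_eq_intI.
- apply: measurable_funX; apply: measurable_funM.
    by apply: measurable_dot => //; exact: measI2_rot.
  apply: measurable_inv_comp; last by move=> x; rewrite exprn_ge0// enorm_ge0.
  by apply: measurable_funX; exact: measurable_enorm.
- apply: measurable_funM; first exact: measurable_cst.
  by apply: measurable_funD; apply: measurable_funX; case: mw.
- apply: (ae_imply (ae_and (rep_ae r) (rep_ortho r))) => x Ix [[h1 h2] h3].
  have sp := rep_speed r Ix.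
  rewrite /curvature h1 h2 (enorm_eq (ltW L0) sp).
  rewrite exprMn.
  (* Lagrange's identity; orthogonality removes the last square, and [L^2 / L^6] leaves [L^-4]. *)
  have -> : dot (w x) (rot90 (u x)) ^+ 2 = dot (w x) (w x) * dot (u x) (u x) - dot (w x) (u x) ^+ 2.
    by rewrite /dot /rot90/=; ring.
  rewrite h3 sp expr0n subr0 /dot -!expr2 -/(cx w x) -/(cy w x).
  by field; rewrite gt_eqF.
Qed.

(** With the continuous tangents as integrands, uniform convergence suffices to pass to the
    limit. *)
Lemma rep_dissip gam1 u1 w1 L1 gam2 u2 w2 L2 :
  h2rep gam1 u1 w1 L1 -> h2rep gam2 u2 w2 L2 ->
  dissip gam1 gam2 =
  (4 * L2)^-1 * intI (fun s => dot (gam1 s - gam2 s) (rot90 (u2 s)) ^+ 2)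
  + (4 * L1)^-1 * intI (fun s => dot (gam1 s - gam2 s) (rot90 (u1 s)) ^+ 2)
  + 2^-1 * enorm (gam1 0 - gam2 0) ^+ 2
  + 2^-1 * enorm (gam1 1 - gam2 1) ^+ 2.
Proof.
move=> r1 r2; rewrite /dissip (rep_clength r1) (rep_clength r2).
have [mg1 mu1 _ md1 _] := rep_meas r1; have [mg2 mu2 _ md2 _] := rep_meas r2.
have m (a : R -> R * R) : measI2 a ->
    measurable_fun I (fun s => dot (gam1 s - gam2 s) (rot90 (a s)) ^+ 2).
  move=> ma; apply: measurable_funX; apply: measurable_dot; first exact: measI2B.
  exact: measI2_rot.
congr (_ * _ + _ * _ + _ + _); apply: ae_eq_intI; try exact: m.
- by apply: (ae_imply (rep_ae r2)) => x _ [-> _].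
- by apply: (ae_imply (rep_ae r1)) => x _ [-> _].
Qed.

Lemma dot_le_enorm (a b : R * R) : dot a b <= enorm a * enorm b.
Proof.
apply: le_trans (ler_norm _) _; apply: ler_norm_of_sqr.
  by rewrite mulr_ge0 ?enorm_ge0.
rewrite exprMn !sqr_enorm /dot -subr_ge0.
have -> : (a.1 * a.1 + a.2 * a.2) * (b.1 * b.1 + b.2 * b.2) -
  (a.1 * b.1 + a.2 * b.2) ^+ 2 = (a.1 * b.2 - a.2 * b.1) ^+ 2 by ring.
exact: sqr_ge0.
Qed.

Lemma primI1 f : primI f 1 = intI f.
Proof.
by apply: eq_intI => x /mem_unitI/andP[_ ->]; rewrite mulr1.
Qed.

(** Pair the chord [d] with itself: [|d|^2] is the integral of [<d | u>], at most [|d| L]; then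
    divide by [|d|]. *)
Lemma rep_chord gam u w L : h2rep gam u w L -> enorm (gam 1 - gam 0) <= L.
Proof.
move=> r; have I1 : I 1 by apply/mem_unitI; rewrite ler01 lexx.
have L0 := rep_ge0 r.
have := wderiv_primI_continuous (rep_cx r) (rep_dx r) I1.
have := wderiv_primI_continuous (rep_cy r) (rep_dy r) I1.
rewrite !primI1 => hy hx; set d := gam 1 - gam 0.
have d1 : d.1 = intI (cx u) by rewrite /d/= -/(cx gam 1) hx /cx addrAC subrr add0r.
have d2 : d.2 = intI (cy u) by rewrite /d/= -/(cy gam 1) hy /cy addrAC subrr add0r.
have iux := mbI_integrable (continuousI_mb (rep_ux r)).
have iuy := mbI_integrable (continuousI_mb (rep_uy r)).
have [->//|dn0] := eqVneq (enorm d) 0.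
have d0 : 0 < enorm d by rewrite lt_neqAle eq_sym dn0 enorm_ge0.
have E : enorm d ^+ 2 = intI (fun x => d.1 * cx u x + d.2 * cy u x).
  rewrite sqr_enorm /dot {2}d1 {2}d2 -!intIZ// -intID//; exact: integrableIZ.
rewrite -(ler_pM2l d0) -expr2 E -[leRHS]intI_cst; apply: le_intI.
- by apply: integrableID; exact: integrableIZ.
- exact/mbI_integrable/mbI_cst.
- move=> x Ix; apply: (le_trans (dot_le_enorm d (u x))).
  by rewrite (enorm_eq L0 (rep_speed r Ix)).
Qed.

Lemma wderiv_hoelder f g : {within I, continuous f} -> is_wderiv f g -> forall s t,
  I s -> I t -> (f t - f s) ^+ 2 <= sqnI g * `|t - s|.
Proof.
move=> fc fg s t Is It; have E := wderiv_primI_continuous fc fg.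
rewrite (E t It) (E s Is) opprD addrACA subrr add0r.
by apply: primI_hoelder; [exact: fg.1|exact/mem_unitI..].
Qed.

Lemma eq_curve_deriv gam1 gam2 : (forall x, I x -> gam1 x = gam2 x) ->
  curve_deriv gam1 = curve_deriv gam2.
Proof.
move=> g12; rewrite /curve_deriv.
rewrite (@eq_wderiv (fun t => (gam1 t).1) (fun t => (gam2 t).1)).
  rewrite (@eq_wderiv (fun t => (gam1 t).2) (fun t => (gam2 t).2))//.
  by move=> x Ix; rewrite g12.
by move=> x Ix; rewrite g12.
Qed.

Lemma eq_h2rep gam1 gam2 u w L : (forall x, I x -> gam1 x = gam2 x) ->
  h2rep gam2 u w L -> h2rep gam1 u w L.
Proof.
move=> g12 [cx_ cy_ ux uy dx dy ddx ddy L0 sp].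
split; [| |exact: ux|exact: uy| | |exact: ddx|exact: ddy|exact: L0|exact: sp].
- apply: subspace_eq_continuous cx_ => x; rewrite inE => Ix.
  by rewrite /from_subspace /cx g12.
- apply: subspace_eq_continuous cy_ => x; rewrite inE => Ix.
  by rewrite /from_subspace /cy g12.
- by apply: eq_is_wderiv dx => x Ix; rewrite /cx g12.
- by apply: eq_is_wderiv dy => x Ix; rewrite /cy g12.
Qed.

Lemma eq_AC gam1 gam2 : (forall x, I x -> gam1 x = gam2 x) ->
  ACcurve gam2 -> ACcurve gam1.
Proof.
move=> g12 ac; have [u [w r]] := AC_rep ac.
have [_ _ g01] := ac.
apply: (rep_AC (eq_h2rep g12 r)).
by rewrite !g12//; apply/mem_unitI; rewrite ?lexx ?ler01.
Qed.

Lemma eq_energy eps gam1 gam2 : (forall x, I x -> gam1 x = gam2 x) ->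
  energy eps gam1 = energy eps gam2.
Proof.
move=> g12; have E := eq_curve_deriv g12.
rewrite /energy /clength E.
have -> : curvature gam1 = curvature gam2 by apply/funext => x; rewrite /curvature E.
by rewrite !g12//; apply/mem_unitI; rewrite ?lexx ?ler01.
Qed.

End curves.

(** * Uniform convergence along an ultrafilter *)

Section uniform_convergence.
Context {R : realType}.
Notation I := (unitI R).
Context (F : set_system nat) {FF : UltraFilter F}.
Implicit Types (f : nat -> R -> R) (g h : R -> R) (a : nat -> R) (C M e s t x : R).

Definition ucvgI f g := forall e, 0 < e ->
  \forall k \near F, forall x, I x -> `|f k x - g x| <= e.

(** Compactness gives a cluster point, and a cluster point of an ultrafilter is a limit: otherwise
    the preimage of the complement of some neighbourhood would belong to the ultrafilter. *)
Lemma ultra_bounded_cvg a C : (forall k, `|a k| <= C) ->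
  exists l : R, a k @[k --> F] --> l.
Proof.
move=> aC; have Fc : (a @ F) `[- C, C]%classic.
  by apply: nearW => k /=; rewrite in_itv/= -ler_norml.
have [l [_ lc]] := @segment_compact R (- C) C _ _ Fc.
exists l => B lB; have [//|FnB] := in_ultra_setVsetC (a @^-1` B) FF.
have [x [nBx Bx]] := lc (~` B) B FnB lB.
by [].
Qed.

Lemma cvg_sqr_le a (l : R) M : a k @[k --> F] --> l ->
  (forall k, a k ^+ 2 <= M) -> l ^+ 2 <= M.
Proof.
move=> al aM; apply: (@ler_cvg_to _ F _ _ (fun k => a k ^+ 2) (fun=> M)).
- by under eq_fun do rewrite expr2; rewrite expr2; exact: cvgM.
- exact: cvg_cst.
- exact: nearW.
Qed.

(** Pointwise limits exist at all points at once along the ultrafilter. The common Hoelder modulus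
    passes to the limit and reduces uniform closeness to finitely many grid points. *)
Lemma ultra_ascoli f C M : (forall k x, I x -> `|f k x| <= C) ->
  (forall k s t, I s -> I t -> (f k t - f k s) ^+ 2 <= M * `|t - s|) ->
  exists g, ucvgI f g /\
    forall s t, I s -> I t -> (g t - g s) ^+ 2 <= M * `|t - s|.
Proof.
move=> fC fM.
have ex x : exists l : R, I x -> f k x @[k --> F] --> l.
  have [Ix|nIx] := pselect (I x); last by exists 0.
  have [l fl] := @ultra_bounded_cvg (fun k => f k x) C (fun k => fC k x Ix).
  by exists l.
have [g fg] := choice ex.
have gM s t : I s -> I t -> (g t - g s) ^+ 2 <= M * `|t - s|.
  move=> Is It; apply: (@cvg_sqr_le (fun k => f k t - f k s)) => [|k]; last exact: fM.
  by apply: cvgB; exact: fg.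
exists g; split=> // e e0.
have I0 : I 0 by apply/mem_unitI; rewrite lexx ler01.
have I1 : I 1 by apply/mem_unitI; rewrite lexx ler01.
have M0 : 0 <= M.
  have := gM _ _ I0 I1; rewrite subr0 normr1 mulr1; exact/le_trans/sqr_ge0.
have e30 : 0 < e / 3 by rewrite divr_gt0.
(* The mesh [1 / N] makes the oscillation between neighbouring grid points at most [e / 3]. *)
pose N := (Num.truncn (M / (e / 3) ^+ 2)).+1.
have NM : M <= (e / 3) ^+ 2 * N%:R.
  rewrite mulrC -ler_pdivrMr ?exprn_gt0//; apply: ltW; exact: truncnS_gt.
have N0 : 0 < N%:R :> R by rewrite ltr0n.
have grid : \forall k \near F, forall j : 'I_N.+1,
    `|f k (j%:R / N%:R) - g (j%:R / N%:R)| <= e / 3.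
  apply: filter_forall => j.
  have Ij : I (j%:R / N%:R).
    apply/mem_unitI; rewrite divr_ge0//= ler_pdivrMr// mul1r ler_nat.
    by rewrite -ltnS.
  have /cvgrPdist_le/(_ _ e30) := fg _ Ij.
  by apply: filterS => k; rewrite distrC.
apply: filterS grid => k gk x Ix.
have /mem_unitI/andP[x0 x1] := Ix.
(* Index of the grid point just left of [x]; [j = N] occurs at [x = 1], hence [N.+1] grid points. *)
pose j := Num.truncn (x * N%:R).
have xN0 : 0 <= x * N%:R by rewrite mulr_ge0// ltW.
have [jx xj] : j%:R <= x * N%:R /\ x * N%:R < j.+1%:R.
  by have /andP[] := truncn_itv xN0.
have jN : (j < N.+1)%N.
  by rewrite ltnS -(ler_nat R) (le_trans jx)// -[leRHS]mul1r ler_wpM2r// ltW.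
have := gk (Ordinal jN); rewrite /=; set y := j%:R / N%:R => gy.
have Iy : I y.
  apply/mem_unitI; rewrite divr_ge0//= ler_pdivrMr// mul1r ler_nat.
  by rewrite -ltnS.
have xy : `|x - y| <= N%:R^-1.
  have yx : y <= x by rewrite ler_pdivrMr.
  rewrite ger0_norm ?subr_ge0// lerBlDl.
  have -> : y + N%:R^-1 = j.+1%:R / N%:R by rewrite /y -natr1 mulrDl mul1r.
  by rewrite ler_pdivlMr//; apply: ltW.
have small : M * `|x - y| <= (e / 3) ^+ 2.
  apply: (@le_trans _ _ (M * N%:R^-1)); first by rewrite ler_wpM2l.
  by rewrite ler_pdivrMr.
have h1 : `|f k x - f k y| <= e / 3.
  apply: ler_norm_of_sqr; first exact: ltW.
  by apply: le_trans (fM _ _ _ Iy Ix) small.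
have h2 : `|g x - g y| <= e / 3.
  apply: ler_norm_of_sqr; first exact: ltW.
  by apply: le_trans (gM _ _ Iy Ix) small.
have -> : f k x - g x = (f k x - f k y) + (f k y - g y) - (g x - g y) by ring.
apply: (le_trans (ler_normB _ _)).
have := ler_normD (f k x - f k y) (f k y - g y).
by move=> ?; lra.
Qed.

Lemma ucvgI_cst h : ucvgI (fun=> h) h.
Proof. by move=> e e0; apply: nearW => k x _; rewrite subrr normr0 ltW. Qed.

Lemma ucvgID f1 f2 g1 g2 : ucvgI f1 g1 -> ucvgI f2 g2 ->
  ucvgI (fun k x => f1 k x + f2 k x) (fun x => g1 x + g2 x).
Proof.
move=> h1 h2 e e0; have e20 : 0 < e / 2 by rewrite divr_gt0.
apply: filterS2 (h1 _ e20) (h2 _ e20) => k {}h1 {}h2 x Ix.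
have := h1 _ Ix; have := h2 _ Ix.
have -> : f1 k x + f2 k x - (g1 x + g2 x) = (f1 k x - g1 x) + (f2 k x - g2 x) by ring.
have := ler_normD (f1 k x - g1 x) (f2 k x - g2 x); lra.
Qed.

Lemma ucvgIM f1 f2 g1 g2 : mbI g1 -> mbI g2 -> ucvgI f1 g1 -> ucvgI f2 g2 ->
  ucvgI (fun k x => f1 k x * f2 k x) (fun x => g1 x * g2 x).
Proof.
move=> [_ [M1 b1]] [_ [M2 b2]] h1 h2 e e0.
have I0 : I 0 by apply/mem_unitI; rewrite lexx ler01.
have M10 : 0 <= M1 by exact: le_trans (b1 _ I0).
have M20 : 0 <= M2 by exact: le_trans (b2 _ I0).
(* [d <= 1] makes the product of the two errors at most [d], so the total error is at most
   [d * (M1 + M2 + 1)]. *)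
pose d := Num.min 1 (e / (M1 + M2 + 1)).
have S0 : 0 < M1 + M2 + 1 by rewrite ltr_wpDl// addr_ge0.
have d0 : 0 < d by rewrite lt_min ltr01 divr_gt0.
have d1 : d <= 1 by rewrite ge_min lexx.
have de : d * (M1 + M2 + 1) <= e.
  by rewrite -ler_pdivlMr// ge_min lexx orbT.
apply: filterS2 (h1 _ d0) (h2 _ d0) => k {}h1 {}h2 x Ix.
have -> : f1 k x * f2 k x - g1 x * g2 x =
  (f1 k x - g1 x) * (f2 k x - g2 x) + (f1 k x - g1 x) * g2 x + g1 x * (f2 k x - g2 x) by ring.
have {}h1 := h1 _ Ix; have {}h2 := h2 _ Ix; have {}b1 := b1 _ Ix; have {}b2 := b2 _ Ix.
apply: (le_trans (ler_normD _ _)); rewrite [X in _ + X]normrM.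
apply: (@le_trans _ _ (d * 1 + d * M2 + M1 * d)); last by move: de; lra.
apply: lerD; last exact: ler_pM.
apply: (le_trans (ler_normD _ _)); rewrite !normrM.
by apply: lerD; apply: ler_pM => //; exact: le_trans h2 d1.
Qed.

Lemma ucvgI_sqr f g : mbI g -> ucvgI f g ->
  ucvgI (fun k x => f k x ^+ 2) (fun x => g x ^+ 2).
Proof. by move=> gb fg; exact: ucvgIM. Qed.

Lemma ucvgIB f1 f2 g1 g2 : mbI g2 -> ucvgI f1 g1 -> ucvgI f2 g2 ->
  ucvgI (fun k x => f1 k x - f2 k x) (fun x => g1 x - g2 x).
Proof.
move=> b2 h1 h2.
have := ucvgID h1 (ucvgIM (mbI_cst (-1)) b2 (ucvgI_cst (fun=> -1)) h2).
have -> : (fun k x => f1 k x + -1 * f2 k x) = (fun k x => f1 k x - f2 k x).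
  by apply/funext => k; apply/funext => x; rewrite mulN1r.
by have -> : (fun x => g1 x + -1 * g2 x) = (fun x => g1 x - g2 x)
  by apply/funext => x; rewrite mulN1r.
Qed.

Lemma ucvgI_pt f g x : ucvgI f g -> I x -> f k x @[k --> F] --> g x.
Proof.
move=> fg Ix; apply/cvgrPdist_le => e e0.
by apply: filterS (fg _ e0) => k /(_ _ Ix); rewrite distrC.
Qed.

Lemma ucvgI_int f g : (forall k, mbI (f k)) -> mbI g -> ucvgI f g ->
  intI (f k) @[k --> F] --> intI g.
Proof.
move=> fb gb fg; apply/cvgrPdist_le => e e0.
apply: filterS (fg _ e0) => k fk.
rewrite -intIB; [|exact: mbI_integrable..].
apply: ler_norm_intI; first by apply: integrableIB; exact: mbI_integrable.
by move=> x Ix; rewrite distrC; exact: fk.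
Qed.

Lemma ucvgI_wderiv f f' g g' : (forall k, mbI (f k)) -> (forall k, mbI (f' k)) ->
  mbI g -> mbI g' -> ucvgI f g -> ucvgI f' g' ->
  (forall k, is_wderiv (f k) (f' k)) -> is_wderiv g g'.
Proof.
move=> fb fb' gb gb' fg fg' ff'; split; first exact: mbI_L2.
move=> phi tphi; have pb := continuous_mbI (test_function_continuous tphi).
have db : mbI (derive1 phi) by apply: continuous_mbI; case: tphi.
have L1 : intI (fun s => f k s * derive1 phi s) @[k --> F] -->
    intI (fun s => g s * derive1 phi s).
  apply: ucvgI_int; [by move=> k; exact: mbIM|exact: mbIM|].
  exact: ucvgIM (ucvgI_cst _).
have L2 : - intI (fun s => f' k s * phi s) @[k --> F] --> - intI (fun s => g' s * phi s).
  apply: cvgN; apply: ucvgI_int; [by move=> k; exact: mbIM|exact: mbIM|].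
  exact: ucvgIM (ucvgI_cst _).
apply: (cvg_unique _ L1) => //.
apply: cvg_trans L2; apply: near_eq_cvg; apply: nearW => k /=.
by have [_ ->] := ff' k.
Qed.

End uniform_convergence.

(** * Energy and dissipation *)

Section minimizing_movement_step.
Context {R : realType}.
Notation mu := (@lebesgue_measure R).
Notation I := (unitI R).
Implicit Types (gam u w : R -> R * R) (eps tau : R).

(** [expR (x / 2)] is the square of [expR (x / 4) >= 1 + x / 4], and
    [(1 + x / 4)^2 - x = (1 - x / 4)^2]. *)
Lemma ln_le_half (x : R) : 0 < x -> ln x <= x / 2.
Proof.
move=> x0; rewrite -[leRHS]expRK ler_ln ?posrE ?expR_gt0//.
have -> : expR (x / 2) = expR (x / 4) ^+ 2.
  by rewrite -expRM_natl; congr expR; field.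
have h : 1 + x / 4 <= expR (x / 4) by exact: expR_ge1Dx.
have h0 : 0 <= 1 + x / 4 by lra.
have := sqr_ge0 (1 - x / 4).
by move: h h0; set E := expR _; nra.
Qed.

Lemma enorm_sub_gt0 (a b : R * R) : a <> b -> 0 < enorm (b - a).
Proof.
move=> ab; rewrite lt_neqAle enorm_ge0 andbT eq_sym; apply/eqP => n0; apply: ab.
have : dot (b - a) (b - a) = 0 by rewrite -sqr_enorm n0 expr0n.
rewrite /dot -!expr2 => /eqP; rewrite paddr_eq0 ?sqr_ge0// !sqrf_eq0/= !subr_eq0.
by case: a b {n0} => [a1 a2] [b1 b2] /= /andP[/eqP -> /eqP ->].
Qed.

(** Discarding the curvature and using [ln d <= L / 2] bounds [L]. Discarding the length and the
    curvature leaves [- ln d <= B]. Finally [L - ln d >= 0] leaves [eps / 2 * L * K <= B], where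
    [L >= d >= expR (- B)]. *)
Lemma energy_bounds eps gam (B : R) : 0 < eps -> ACcurve gam -> energy eps gam <= B ->
  [/\ expR (- B) <= enorm (gam 1 - gam 0),
      enorm (gam 1 - gam 0) <= clength gam,
      clength gam <= 2 * B &
      intI (fun s => curvature gam s ^+ 2) <= 2 * B / (eps * expR (- B))].
Proof.
move=> eps0 ac; have [u [w r]] := AC_rep ac; have [_ _ g01] := ac.
have dL := rep_chord r; have d0 := enorm_sub_gt0 g01.
rewrite /energy; set L := clength gam in dL *; set d := enorm _ in dL d0 *.
have K0 : 0 <= intI (fun s => curvature gam s ^+ 2).
  by apply: intI_ge0 => x _; exact: sqr_ge0.
set K := intI _ in K0 *.
have L0 : 0 < L by exact: lt_le_trans dL.
have hl : ln d <= L / 2.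
  by apply: le_trans (ln_le_half L0); rewrite ler_ln.
have t0 : 0 <= eps / 2 * L * K.
  by rewrite !mulr_ge0// ?divr_ge0// ltW.
move=> EB; have LB : L <= 2 * B by lra.
have cd : expR (- B) <= d by rewrite -[leRHS]lnK ?posrE// ler_expR; lra.
split=> //.
have B0 : 0 <= B by lra.
have c0 : 0 < expR (- B) by exact: expR_gt0.
rewrite ler_pdivlMr ?mulr_gt0//.
have : K * (eps * expR (- B)) <= K * (eps * L).
  by rewrite ler_wpM2l// ler_wpM2l ?(ltW eps0)//; exact: le_trans dL.
by move=> h; apply: (le_trans h); nra.
Qed.

Lemma energy_ge0 eps gam : 0 < eps -> ACcurve gam -> 0 <= energy eps gam.
Proof.
(* Taking [B] to be the energy itself gives [0 <= chord <= L <= 2 B]. *)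
move=> eps0 ac; have [_ h1 h2 _] := energy_bounds eps0 ac (lexx _).
have := enorm_ge0 (gam 1 - gam 0); lra.
Qed.

Lemma clength_ge0 gam : 0 <= clength gam.
Proof. by apply: intI_ge0 => x _; exact: enorm_ge0. Qed.

(** Bounds the displacement of the starting point; together with the length bound this confines the
    whole curve. *)
Lemma dissip_chord gam1 gam2 :
  2^-1 * enorm (gam1 0 - gam2 0) ^+ 2 <= dissip gam1 gam2.
Proof.
rewrite /dissip -addrA addrC -addrA lerDl addr_ge0//.
  by rewrite mulr_ge0// ?invr_ge0// sqr_ge0.
by rewrite addr_ge0// mulr_ge0 ?invr_ge0 ?mulr_ge0 ?clength_ge0//;
  apply: intI_ge0 => x _; exact: sqr_ge0.
Qed.

Lemma dissip_ge0 gam1 gam2 : 0 <= dissip gam1 gam2.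
Proof.
by apply: le_trans (dissip_chord _ _); rewrite mulr_ge0 ?invr_ge0// sqr_ge0.
Qed.

Lemma dissip_refl gam : dissip gam gam = 0.
Proof.
have dot0 (b : R * R) : dot 0 b = 0 by rewrite /dot /= !mul0r addr0.
rewrite /dissip !subrr /enorm dot0 sqrtr0 expr0n/= !mulr0 !addr0.
have -> : intI (fun s => dot (gam s - gam s) (rot90 (curve_deriv gam s)) ^+ 2) = 0.
  by rewrite -[RHS](intI_cst 0); apply: eq_intI => x _; rewrite subrr dot0 expr0n.
by rewrite mulr0 addr0.
Qed.

Lemma ACfrom_refl gam : ACcurve gam -> ACfrom gam gam.
Proof. by move=> ac; split=> //; apply: aeW => x _; exact: dot_ge0. Qed.

Lemma step_energy_le eps tau gam1 gam2 : 0 < tau -> ACcurve gam1 ->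
  step_argmin eps tau gam1 gam2 -> energy eps gam2 <= energy eps gam1.
Proof.
move=> tau0 ac [_ /(_ _ (ACfrom_refl ac))]; rewrite dissip_refl mulr0 addr0.
by apply: le_trans; rewrite lerDl mulr_ge0 ?dissip_ge0// invr_ge0 ltW.
Qed.

Lemma sqnI_le f (C : R) : mbI f -> (forall x, I x -> `|f x| <= C) -> sqnI f <= C ^+ 2.
Proof.
move=> fb fC; rewrite -[leRHS]intI_cst; apply: le_intI.
- exact/mbI_integrable/mbI_sqr.
- exact/mbI_integrable/mbI_cst.
- move=> x Ix; rewrite -real_normK ?num_real// lerXn2r ?nnegrE ?fC//.
  exact: le_trans (fC _ Ix).
Qed.

Lemma dot_rotE (a b v : R * R) :
  dot (a - b) (rot90 v) = (a.2 - b.2) * v.1 - (a.1 - b.1) * v.2.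
Proof. by rewrite /dot /rot90/=; ring. Qed.

Definition mbI2 gam := mbI (cx gam) /\ mbI (cy gam).

Lemma mbI_dot_rot (a b v : R -> R * R) : mbI2 a -> mbI2 b -> mbI2 v ->
  mbI (fun s => dot (a s - b s) (rot90 (v s)) ^+ 2).
Proof.
move=> [ax ay] [bx by_] [vx vy].
have -> : (fun s => dot (a s - b s) (rot90 (v s)) ^+ 2) =
    (fun s => ((cy a s - cy b s) * cx v s - (cx a s - cx b s) * cy v s) ^+ 2).
  by apply/funext => s; rewrite dot_rotE.
by apply: mbI_sqr; apply: mbIB; apply: mbIM => //; exact: mbIB.
Qed.

Definition ucvgI2 (F : set_system nat) (p : nat -> R -> R * R) gam :=
  ucvgI F (fun k => cx (p k)) (cx gam) /\ ucvgI F (fun k => cy (p k)) (cy gam).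

Lemma cvg_int_dot_rot (F : set_system nat) {FF : UltraFilter F}
    (p v : nat -> R -> R * R) gam b u :
  (forall k, mbI2 (p k)) -> (forall k, mbI2 (v k)) -> mbI2 gam -> mbI2 b -> mbI2 u ->
  ucvgI2 F p gam -> ucvgI2 F v u ->
  intI (fun s => dot (p k s - b s) (rot90 (v k s)) ^+ 2) @[k --> F] -->
  intI (fun s => dot (gam s - b s) (rot90 (u s)) ^+ 2).
Proof.
move=> pb vb gb bb ub [pgx pgy] [vux vuy].
have [gbx gby] := gb; have [bbx bby] := bb; have [ubx uby] := ub.
apply: ucvgI_int => [k||]; [exact: mbI_dot_rot|exact: mbI_dot_rot|].
have -> : (fun k s => dot (p k s - b s) (rot90 (v k s)) ^+ 2) =
    (fun k s => ((cy (p k) s - cy b s) * cx (v k) s - (cx (p k) s - cx b s) * cy (v k) s) ^+ 2).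
  by apply/funext => k; apply/funext => s; rewrite dot_rotE.
have -> : (fun s => dot (gam s - b s) (rot90 (u s)) ^+ 2) =
    (fun s => ((cy gam s - cy b s) * cx u s - (cx gam s - cx b s) * cy u s) ^+ 2).
  by apply/funext => s; rewrite dot_rotE.
have h1 : ucvgI F (fun k s => cy (p k) s - cy b s) (fun s => cy gam s - cy b s).
  by apply: ucvgIB => //; exact: ucvgI_cst.
have h2 : ucvgI F (fun k s => cx (p k) s - cx b s) (fun s => cx gam s - cx b s).
  by apply: ucvgIB => //; exact: ucvgI_cst.
have m1 := mbIB gby bby; have m2 := mbIB gbx bbx.
apply: ucvgI_sqr; first by apply: mbIB; exact: mbIM.
apply: ucvgIB; [exact: mbIM|exact: ucvgIM|exact: ucvgIM].
Qed.

Lemma cvg_dot (F : set_system nat) {FF : ProperFilter F} (a b : nat -> R * R) (c d : R * R) :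
  (a k).1 @[k --> F] --> c.1 -> (a k).2 @[k --> F] --> c.2 ->
  (b k).1 @[k --> F] --> d.1 -> (b k).2 @[k --> F] --> d.2 ->
  dot (a k) (b k) @[k --> F] --> dot c d.
Proof. by move=> a1 a2 b1 b2; apply: cvgD; exact: cvgM. Qed.

Lemma cvg_enormB (F : set_system nat) {FF : ProperFilter F} (a b : nat -> R * R) (c d : R * R) :
  (a k).1 @[k --> F] --> c.1 -> (a k).2 @[k --> F] --> c.2 ->
  (b k).1 @[k --> F] --> d.1 -> (b k).2 @[k --> F] --> d.2 ->
  enorm (a k - b k) @[k --> F] --> enorm (c - d).
Proof.
move=> a1 a2 b1 b2.
have h : dot (a k - b k) (a k - b k) @[k --> F] --> dot (c - d) (c - d).
  have h1 : (a k - b k).1 @[k --> F] --> (c - d).1 by exact: (cvgB a1 b1).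
  have h2 : (a k - b k).2 @[k --> F] --> (c - d).2 by exact: (cvgB a2 b2).
  exact: cvg_dot.
exact: (cvg_comp _ _ h (@sqrt_continuous R _)).
Qed.

Lemma cvg_sqr (F : set_system nat) {FF : Filter F} (l : nat -> R) (l' : R) :
  l k @[k --> F] --> l' -> l k ^+ 2 @[k --> F] --> l' ^+ 2.
Proof. by move=> h; under eq_fun do rewrite expr2; rewrite expr2; exact: cvgM. Qed.

Lemma rep_mb gam u w L : h2rep gam u w L -> mbI2 gam /\ mbI2 u.
Proof.
move=> r; split; split; apply: continuousI_mb.
- exact: rep_cx r.
- exact: rep_cy r.
- exact: rep_ux r.
- exact: rep_uy r.
Qed.

End minimizing_movement_step.

(** * The direct method *)

Section existence_of_step.
Context {R : realType}.
Notation mu := (@lebesgue_measure R).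
Notation I := (unitI R).
Implicit Types (gam u w : R -> R * R) (eps tau : R).

(** The limits [Mx] and [My] of the squared norms are returned as well, because semicontinuity must
    be compared with the limit of the energies along the same ultrafilter. *)
Lemma rep_limit (G : set_system nat) {GG : UltraFilter G}
    (p u w : nat -> R -> R * R) (L : nat -> R) (A B W : R) :
  (forall k, h2rep (p k) (u k) (w k) (L k)) ->
  (forall k x, I x -> `|cx (p k) x| <= A /\ `|cy (p k) x| <= A) ->
  (forall k, L k <= B) ->
  (forall k, sqnI (cx (w k)) <= W /\ sqnI (cy (w k)) <= W) ->
  exists gam u' w' L' Mx My,
    [/\ h2rep gam u' w' L', ucvgI2 G p gam /\ ucvgI2 G u u',
        L k @[k --> G] --> L',
        sqnI (cx (w k)) @[k --> G] --> Mx /\ sqnI (cy (w k)) @[k --> G] --> My &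
        sqnI (cx w') <= Mx /\ sqnI (cy w') <= My].
Proof.
move=> r pA LB wW.
have pm k := rep_mb (r k).
have L0 k : 0 <= L k := rep_ge0 (r k).
have ub k := rep_bound (r k).
have H (f g : nat -> R -> R) : (forall k, {within I, continuous (f k)}) ->
    (forall k, is_wderiv (f k) (g k)) -> (forall k x, I x -> `|g k x| <= B) ->
    (forall k, mbI (g k)) -> forall k s t, I s -> I t ->
    (f k t - f k s) ^+ 2 <= B ^+ 2 * `|t - s|.
  move=> fc fg gB gb k s t Is It; apply: (le_trans (wderiv_hoelder (fc k) (fg k) Is It)).
  by rewrite ler_wpM2r//; apply: sqnI_le => // x; exact: gB.
have uB k x : I x -> `|cx (u k) x| <= B /\ `|cy (u k) x| <= B.
  by move=> Ix; have [h1 h2] := ub k x Ix; split; [exact: le_trans h1 _|exact: le_trans h2 _].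
have hux k s t : I s -> I t -> (cx (u k) t - cx (u k) s) ^+ 2 <= W * `|t - s|.
  move=> Is It; apply: (le_trans (wderiv_hoelder (rep_ux (r k)) (rep_ddx (r k)) Is It)).
  by rewrite ler_wpM2r//; exact: (wW k).1.
have huy k s t : I s -> I t -> (cy (u k) t - cy (u k) s) ^+ 2 <= W * `|t - s|.
  move=> Is It; apply: (le_trans (wderiv_hoelder (rep_uy (r k)) (rep_ddy (r k)) Is It)).
  by rewrite ler_wpM2r//; exact: (wW k).2.
have [gx [gxc gxh]] := ultra_ascoli (fun k x Ix => (pA k x Ix).1)
  (H _ _ (fun k => rep_cx (r k)) (fun k => rep_dx (r k)) (fun k x Ix => (uB k x Ix).1)
     (fun k => (pm k).2.1)).
have [gy [gyc gyh]] := ultra_ascoli (fun k x Ix => (pA k x Ix).2)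
  (H _ _ (fun k => rep_cy (r k)) (fun k => rep_dy (r k)) (fun k x Ix => (uB k x Ix).2)
     (fun k => (pm k).2.2)).
have [ux [uxc uxh]] := ultra_ascoli (fun k x Ix => (uB k x Ix).1) hux.
have [uy [uyc uyh]] := ultra_ascoli (fun k x Ix => (uB k x Ix).2) huy.
have [L' LL'] : exists l : R, L k @[k --> G] --> l.
  by apply: (@ultra_bounded_cvg _ G _ L B) => k; rewrite ger0_norm.
have [Mx sMx] : exists l : R, sqnI (cx (w k)) @[k --> G] --> l.
  apply: (@ultra_bounded_cvg _ G _ _ W) => k.
  by rewrite ger0_norm ?sqnI_ge0//; exact: (wW k).1.
have [My sMy] : exists l : R, sqnI (cy (w k)) @[k --> G] --> l.
  apply: (@ultra_bounded_cvg _ G _ _ W) => k.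
  by rewrite ger0_norm ?sqnI_ge0//; exact: (wW k).2.
have gxC := hoelder_continuous gxh; have gyC := hoelder_continuous gyh.
have uxC := hoelder_continuous uxh; have uyC := hoelder_continuous uyh.
have lsc (f h : nat -> R -> R) (g : R -> R) (M : R) : mbI g ->
    (forall k, mbI (f k)) -> (forall k, is_wderiv (f k) (h k)) -> ucvgI G f g ->
    sqnI (h k) @[k --> G] --> M -> exists w0 : R -> R, is_wderiv g w0 /\ sqnI w0 <= M.
  move=> gb fb fh fg hM; apply: wderiv_lsc => // e e0.
  have /cvgrPdist_le/(_ _ e0) hMe := hM.
  (* A single index from the ultrafilter, both uniformly close and with norm close to its limit,
     supplies the approximant required at tolerance [e]. *)
  have [k [fk hk]] := filter_ex (filterI (fg _ e0) hMe).
  exists (f k), (h k); split=> //; first exact: mbI_L2.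
  by move: hk => /=; rewrite ler_distlC => /andP[]; lra.
have [wx [dwx swx]] := lsc _ _ _ _ (continuousI_mb uxC) (fun k => (pm k).2.1)
  (fun k => rep_ddx (r k)) uxc sMx.
have [wy [dwy swy]] := lsc _ _ _ _ (continuousI_mb uyC) (fun k => (pm k).2.2)
  (fun k => rep_ddy (r k)) uyc sMy.
exists (fun x => (gx x, gy x)), (fun x => (ux x, uy x)), (fun x => (wx x, wy x)), L', Mx, My.
split; [|by split; split|exact: LL'|by split|by split].
split; [exact: gxC|exact: gyC|exact: uxC|exact: uyC| | |exact: dwx|exact: dwy| |].
- apply: (ucvgI_wderiv (fun k => (pm k).1.1) (fun k => (pm k).2.1)
    (continuousI_mb gxC) (continuousI_mb uxC) gxc uxc).
  by move=> k; exact: rep_dx (r k).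
- apply: (ucvgI_wderiv (fun k => (pm k).1.2) (fun k => (pm k).2.2)
    (continuousI_mb gyC) (continuousI_mb uyC) gyc uyc).
  by move=> k; exact: rep_dy (r k).
- apply: (@ler_cvg_to _ G _ _ (fun=> 0) L); [exact: cvg_cst|exact: LL'|exact: nearW].
- move=> x Ix.
  have h1 : cx (u k) x @[k --> G] --> ux x by exact: ucvgI_pt uxc Ix.
  have h2 : cy (u k) x @[k --> G] --> uy x by exact: ucvgI_pt uyc Ix.
  have h3 : dot (u k x) (u k x) @[k --> G] --> dot (ux x, uy x) (ux x, uy x).
    exact: cvg_dot.
  apply: (cvg_unique _ h3) => //.
  have h4 : L k * L k @[k --> G] --> L' ^+ 2 by rewrite expr2; exact: cvgM.
  apply: cvg_trans h4; apply: near_eq_cvg; apply: nearW => k.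
  by rewrite (rep_speed (r k) Ix) expr2.
Qed.

Lemma step_argmin_exists eps tau gamt : 0 < eps -> 0 < tau -> ACcurve gamt ->
  exists gam, step_argmin eps tau gamt gam.
Proof.
move=> eps0 tau0 act.
pose Fn gam := energy eps gam + tau^-1 * dissip gam gamt.
have D0 gam : 0 <= tau^-1 * dissip gam gamt.
  by rewrite mulr_ge0 ?dissip_ge0// invr_ge0 ltW.
have Fn0 gam : ACfrom gamt gam -> 0 <= Fn gam.
  by move=> [ac _]; rewrite addr_ge0// energy_ge0.
have lbV : lbound (Fn @` ACfrom gamt) 0 by move=> _ [gam ac <-]; exact: Fn0.
have hV : has_inf (Fn @` ACfrom gamt).
  split; last by exists 0.
  by exists (Fn gamt), gamt => //; exact: ACfrom_refl.
pose m := inf (Fn @` ACfrom gamt).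
have ex (k : nat) : exists gam, ACfrom gamt gam /\ Fn gam <= m + k.+1%:R^-1.
  have k0 : 0 < k.+1%:R^-1 :> R by rewrite invr_gt0.
  have [_ [gam ac <-] h] := inf_adherent k0 hV.
  by exists gam; split=> //; exact: ltW.
have [p pP] := choice ex.
pose B := m + 1.
have FB k : Fn (p k) <= B.
  by apply: (le_trans (pP k).2); rewrite lerD2l invf_le1// ler1n.
have ac k : ACcurve (p k) by have [[]] := pP k.
have EB k : energy eps (p k) <= B by apply: le_trans (FB k); rewrite lerDl.
have bd k := energy_bounds eps0 (ac k) (EB k).
(* The two existentials are packed into one pair so that a whole sequence of representatives can be
   chosen. *)
have [uw rk] := choice (fun k => let: ex_intro u (ex_intro w r) := AC_rep (ac k) in
  ex_intro (fun uw : (R -> R * R) * (R -> R * R) =>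
    h2rep (p k) uw.1 uw.2 (clength (p k))) (u, w) r).
pose u k := (uw k).1; pose w k := (uw k).2; pose L k := clength (p k).
have r k : h2rep (p k) (u k) (w k) (L k) := rk k.
have [ut [wt rt]] := AC_rep act.
pose c := expR (- B); have c0 : 0 < c by exact: expR_gt0.
have cd k : c <= enorm (p k 1 - p k 0) by have [] := bd k.
have cL k : c <= L k by have [h1 h2 _ _] := bd k; exact: le_trans h1 h2.
have LB k : L k <= 2 * B by have [] := bd k.
have L0 k : 0 < L k by exact: lt_le_trans (cL k).
have B0 : 0 < B by have := lt_le_trans (L0 0%N) (LB 0%N); lra.
(* The squared norm of [w k] is [L^4] times the curvature integral, with [L <= 2 B]. *)
pose W := 2 * B / (eps * c) * (2 * B) ^+ 4.
have wW k : sqnI (cx (w k)) <= W /\ sqnI (cy (w k)) <= W.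
  have := rep_curvature (r k) (L0 k).
  have [_ _ _ hk] := bd k; move=> hE; move: hk; rewrite hE ler_pdivrMr ?exprn_gt0// => hk.
  have h : sqnI (cx (w k)) + sqnI (cy (w k)) <= W.
    apply: (le_trans hk); rewrite /W ler_wpM2l ?lerXn2r ?nnegrE ?(ltW (L0 k))//.
    - by rewrite divr_ge0// mulr_ge0// ltW.
    - by rewrite mulr_ge0// ltW.
  by have := sqnI_ge0 (cx (w k)); have := sqnI_ge0 (cy (w k)); split; lra.
have I0 : I 0 by apply/mem_unitI; rewrite lexx ler01.
have I1 : I 1 by apply/mem_unitI; rewrite lexx ler01.
(* The dissipation is at most [tau * B], so the squared displacement of the starting point is at
   most [q = 2 * tau * B], and [q <= (q + 1)^2]. *)
pose T := 2 * tau * B + 1.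
have T0 : 0 < T by rewrite ltr_wpDl// !mulr_ge0// ltW.
have start k : `|cx (p k) 0 - cx gamt 0| <= T /\ `|cy (p k) 0 - cy gamt 0| <= T.
  have h1 : tau^-1 * dissip (p k) gamt <= B.
    by apply: le_trans (FB k); rewrite lerDr energy_ge0.
  have h2 : dissip (p k) gamt <= tau * B by rewrite -ler_pdivrMl.
  have h3 := le_trans (dissip_chord (p k) gamt) h2.
  have h4 : (cx (p k) 0 - cx gamt 0) ^+ 2 + (cy (p k) 0 - cy gamt 0) ^+ 2 <= 2 * tau * B.
    by move: h3; rewrite sqr_enorm /dot/= -!expr2 /cx /cy; lra.
  have T2 : 2 * tau * B <= T ^+ 2.
    have : 0 <= 2 * tau * B by rewrite !mulr_ge0// ltW.
    by rewrite /T; set q := 2 * tau * B; nra.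
  split; apply: ler_norm_of_sqr; rewrite ?(ltW T0)//; apply: le_trans T2; apply: le_trans h4.
  - by rewrite lerDl sqr_ge0.
  - by rewrite lerDr sqr_ge0.
pose A := `|cx gamt 0| + `|cy gamt 0| + T + 2 * B.
have pA k x : I x -> `|cx (p k) x| <= A /\ `|cy (p k) x| <= A.
  move=> Ix; have [sx sy] := start k.
  have /mem_unitI/andP[x0 x1] := Ix.
  have [[_ _] [mux muy]] := rep_mb (r k).
  have hb (f g : R -> R) : {within I, continuous f} -> is_wderiv f g -> mbI g ->
      (forall y, I y -> `|g y| <= L k) -> `|f x - f 0| <= 2 * B.
    move=> fc fg gb gL; apply: ler_norm_of_sqr; first by rewrite mulr_ge0// ltW.
    apply: (le_trans (wderiv_hoelder fc fg I0 Ix)).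
    rewrite subr0 ger0_norm//; apply: (@le_trans _ _ (sqnI g * 1)).
      by rewrite ler_wpM2l// sqnI_ge0.
    by rewrite mulr1; apply: sqnI_le => // y Iy; exact: le_trans (gL _ Iy) (LB k).
  have hx := hb _ _ (rep_cx (r k)) (rep_dx (r k)) mux (fun y Iy => (rep_bound (r k) Iy).1).
  have hy := hb _ _ (rep_cy (r k)) (rep_dy (r k)) muy (fun y Iy => (rep_bound (r k) Iy).2).
  have tri (a b b' : R) : `|a - b| <= 2 * B -> `|b - b'| <= T -> `|a| <= `|b'| + T + 2 * B.
    move=> h1 h2; have -> : a = (a - b) + (b - b') + b' by ring.
    have := ler_normD ((a - b) + (b - b')) b'; have := ler_normD (a - b) (b - b'); lra.
  have := tri _ _ _ hx sx; have := tri _ _ _ hy sy; rewrite /A.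
  have := normr_ge0 (cx gamt 0); have := normr_ge0 (cy gamt 0).
  by move=> *; split; lra.
(* [G] refines the filter at infinity, so the errors [1 / (k + 1)] still vanish along it. *)
have [G [GG sG]] := @ultraFilterLemma nat \oo _.
have [gam [u' [w' [L' [Mx [My [rg [pg uu'] LL' [sMx sMy] [wMx wMy]]]]]]]] :=
  rep_limit r pA LB wW.
have [pgx pgy] := pg; have [uux uuy] := uu'.
have px x : I x -> (p k x).1 @[k --> G] --> (gam x).1 by exact: ucvgI_pt pgx.
have py x : I x -> (p k x).2 @[k --> G] --> (gam x).2 by exact: ucvgI_pt pgy.
have chord : enorm (p k 1 - p k 0) @[k --> G] --> enorm (gam 1 - gam 0).
  by apply: cvg_enormB; [exact: px|exact: py|exact: px|exact: py].
have cchord : c <= enorm (gam 1 - gam 0).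
  by apply: (@ler_cvg_to _ G _ _ (fun=> c) _ _ _ (cvg_cst _) chord); exact: nearW.
have cL' : c <= L' by apply: le_trans cchord (rep_chord rg).
have L'0 : 0 < L' by exact: lt_le_trans cL'.
have g01 : gam 0 <> gam 1.
  move=> g01; move: cchord; rewrite g01 subrr /enorm /dot/= !mul0r addr0 sqrtr0.
  by rewrite leNgt c0.
have acg := rep_AC rg g01.
have fromg : ACfrom gamt gam.
  split=> //.
  (* The exceptional set depends on [k]; the countable union is discarded before the limit is taken
     pointwise. *)
  have aek : {ae mu, forall x, forall k, I x -> 0 <= dot (u k x) (ut x)}.
    apply: ae_foralln => k; have [[_ h] _] := pP k.
    apply: (ae_imply (ae_and h (ae_and (rep_ae (r k)) (rep_ae rt)))).
    by move=> x Ix [h1 [[h2 _] [h3 _]]]; rewrite -h2 -h3.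
  have aek' : {ae mu, forall x, I x -> forall k, 0 <= dot (u k x) (ut x)}.
    apply: (@filterS _ _ (ae_filter_ringOfSetsType mu) _ _ _ aek).
    by move=> x h Ix k; exact: h.
  apply: (ae_imply (ae_and aek' (ae_and (rep_ae rg) (rep_ae rt)))).
  move=> x Ix [h1 [[-> _] [-> _]]].
  have h : dot (u k x) (ut x) @[k --> G] --> dot (u' x) (ut x).
    apply: cvg_dot; [exact: ucvgI_pt uux Ix|exact: ucvgI_pt uuy Ix|exact: cvg_cst|exact: cvg_cst].
  by apply: (@ler_cvg_to _ G _ _ (fun=> 0) _ _ _ (cvg_cst _) h); exact: nearW.
exists gam; split=> // gam2 from2.
have mle : m <= Fn gam2 by apply: ge_inf; [exists 0|exists gam2].
apply: (le_trans _ mle); rewrite -/(Fn gam).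
(* The limit of [Fn (p k)]: the norms of the second derivatives enter through their limits [Mx],
   [My]. Semicontinuity gives [Fn gam <= Fh], the choice of [p] gives [Fh <= m]. *)
pose Fh := L' + eps / 2 * L' * ((Mx + My) / L' ^+ 4) - ln (enorm (gam 1 - gam 0))
  + tau^-1 * dissip gam gamt.
have FFh : Fn gam <= Fh.
  rewrite /Fn /Fh /energy (rep_clength rg) (rep_curvature rg L'0) !lerD2r lerD2l.
  rewrite ler_wpM2l ?mulr_ge0 ?(ltW L'0) ?(ltW eps0)// ?invr_ge0//.
  by rewrite ler_wpM2r ?invr_ge0 ?exprn_ge0 ?(ltW L'0)// lerD.
apply: (le_trans FFh).
have gmb k := (rep_mb (r k)).1; have umb k := (rep_mb (r k)).2.
have [gmb' umb'] := rep_mb rg; have [tmb utmb] := rep_mb rt.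
have utc : ucvgI2 G (fun=> ut) ut by split; exact: ucvgI_cst.
have L'n0 : L' != 0 by rewrite gt_eqF.
have Dcvg : dissip (p k) gamt @[k --> G] --> dissip gam gamt.
  rewrite (rep_dissip rg rt).
  have -> : (fun k => dissip (p k) gamt) = (fun k => _) :=
    funext (fun k => rep_dissip (r k) rt).
  apply: cvgD; last first.
    apply: cvgMr; apply: cvg_sqr; apply: cvg_enormB;
      [exact: px|exact: py|exact: cvg_cst|exact: cvg_cst].
  apply: cvgD; last first.
    apply: cvgMr; apply: cvg_sqr; apply: cvg_enormB;
      [exact: px|exact: py|exact: cvg_cst|exact: cvg_cst].
  apply: cvgD.
    by apply: cvgMr; exact: (cvg_int_dot_rot gmb (fun=> utmb) gmb' tmb utmb pg utc).
  apply: cvgM; last exact: (cvg_int_dot_rot gmb umb gmb' tmb umb' pg uu').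
  by apply: cvgV; [rewrite mulf_neq0|apply: cvgMr].
have Fcvg : Fn (p k) @[k --> G] --> Fh.
  have -> : (fun k => Fn (p k)) = (fun k => L k + eps / 2 * L k *
      ((sqnI (cx (w k)) + sqnI (cy (w k))) / L k ^+ 4)
      - ln (enorm (p k 1 - p k 0)) + tau^-1 * dissip (p k) gamt).
    by apply/funext => k; rewrite /Fn /energy (rep_curvature (r k) (L0 k)).
  apply: cvgD; last exact: cvgMr.
  apply: cvgB; last first.
    apply: (cvg_comp _ _ chord); apply: continuous_ln; exact: lt_le_trans cchord.
  apply: cvgD; first exact: LL'.
  apply: cvgM; first exact: cvgMr.
  apply: cvgM; first exact: cvgD.
  apply: cvgV; first by rewrite expf_neq0.
  by under eq_fun do rewrite (exprM _ 2 2); rewrite (exprM _ 2 2); do 2 apply: cvg_sqr.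
apply: (@ler_cvg_to _ G _ _ (fun k => Fn (p k)) (fun k => m + k.+1%:R^-1) _ m Fcvg).
  have h : m + k.+1%:R^-1 @[k --> \oo] --> m + 0.
    by apply: cvgD; [exact: cvg_cst|exact: cvg_harmonic].
  by move: h; rewrite addr0; apply: cvg_trans => P; exact: sG.
by apply: nearW => k; exact: (pP k).2.
Qed.

End existence_of_step.

(** * Well-posedness of the scheme and bounds uniform in the time step *)

Theorem theorem1 (R : realType) (eps : R) (gamma0 : R -> R * R)
    (eps_gt0 : 0 < eps) (gamma0_AC : ACcurve gamma0) :
  (forall tau : R, 0 < tau -> tau < 1 ->
     forall (n : nat) (g : nat -> R -> R * R),
       scheme_upto eps tau gamma0 n g ->
       exists gamma : R -> R * R, step_argmin eps tau (g n) gamma)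
  /\
  (exists c C : R, [/\ 0 < c, 0 < C &
     forall tau : R, 0 < tau -> tau < 1 ->
     forall g : nat -> R -> R * R, scheme eps tau gamma0 g ->
     forall n : nat,
       [/\ c <= enorm (g n 1 - g n 0),
           enorm (g n 1 - g n 0) <= clength (g n),
           clength (g n) <= C
         & intI (fun s => curvature (g n) s ^+ 2) <= C]]).
Proof.
split.
  move=> tau tau0 _ n g [g0 gS]; apply: step_argmin_exists => //.
  (* Existence only asks that [g n] be admissible: for [n = 0] it agrees with [gamma0] on [[0, 1]],
     later it is the minimizer of the previous step. *)
  case: n gS => [_|n /(_ n (ltnSn n)) [[]//]].
  exact: eq_AC g0 gamma0_AC.
set E := energy eps gamma0.
have E0 : 0 <= E by exact: energy_ge0.
have c0 : 0 < expR (- E) by exact: expR_gt0.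
have K0 : 0 <= 2 * E / (eps * expR (- E)).
  by rewrite divr_ge0 ?mulr_ge0// ?(ltW eps_gt0)// ltW.
(* The constants of the energy bounds at level [E]; their sum dominates both upper bounds, and [+ 1]
   makes it positive when [E = 0]. *)
exists (expR (- E)), (2 * E + 2 * E / (eps * expR (- E)) + 1); split=> //; first by lra.
move=> tau tau0 _ g [g0 gS] n.
have [ac gE] : ACcurve (g n) /\ energy eps (g n) <= E.
  elim: n => [|n [ac gE]].
    by split; [exact: eq_AC g0 gamma0_AC|rewrite (eq_energy eps g0)].
  split; first by have [[]] := gS n.
  exact: le_trans (step_energy_le tau0 ac (gS n)) gE.
have [h1 h2 h3 h4] := energy_bounds eps_gt0 ac gE.
by split=> //; lra.
Qed.
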